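(* Consider the repeated two-player zero-sum Bayesian game with a rate-limited helper described in the context, with finite state set $\mathcal{S}$, finite action sets $\mathcal{A}$ (Player A) and $\mathcal{B}$ (Player B), state distribution $p_S$ and finite real payoff function $\Pi(a,b,s)$ to Player A. (i) Suppose Player B does not know the state sequence. Then an average payoff $P$ for Player A is achievable with a state-information description rate $R$ if there exist a finite-valued auxiliary random variable $U$ and an action $A$ with joint distribution $p_S(s)\,p_{U|S}(u|s)\,p_{A|U}(a|u)$ (so that $S - U - A$ is a Markov chain) such that \[ \underline{\Pi}_{p_{A|S}} > P,\qquad R > I(U;S),\qquad R > I(U;S,A)\,\frac{P - \underline{\Pi}_{p_{A|U}}^{(U)}}{\underline{\Pi}_{p_{A|S}} - \underline{\Pi}_{p_{A|U}}^{(U)}}. \] (ii) Suppose Player B knows the state sequence. Then an average payoff $P$ for Player A is achievable with a state-information description rate $R$ if there exist a finite-valued auxiliary random variable $U$ and an action $A$ with joint distribution $p_S(s)\,p_{U|S}(u|s)\,p_{A|U}(a|u)$ such that \[ \underline{\Pi}_{p_{A|S}}^{(S)} > P,\qquad R > I(U;S) + I(U;A|S)\left(\frac{P - \underline{\Pi}_{p_{A|U}}^{(S,U)}}{\underline{\Pi}_{p_{A|S}}^{(S)} - \underline{\Pi}_{p_{A|U}}^{(S,U)}}\right)^{+}. \]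
   Context: Setting. A two-player zero-sum game has a random state $S$ taking values in a finite set $\mathcal{S}$ with distribution $p_S$; Player A chooses a pure strategy $a\in\mathcal{A}$, Player B chooses $b\in\mathcal{B}$ (finite sets), and Player A receives the finite payoff $\Pi(a,b,s)$ while Player B receives $-\Pi(a,b,s)$. The game is repeated: a block of $n$ iterations is played with states $S_1,\dots,S_n$ i.i.d. according to $p_S$. A helper observes the whole state sequence $S^n=(S_1,\dots,S_n)$ non-causally and sends Player A a message of $nR$ bits (rate $R$ bits per iteration) before play; the helper's encoding and Player A's use of the message may be randomized. At each iteration both players know all past actions and past states. Player B knows the communication protocol (encoder and Player A's strategy) but does not see the message; in case (i) Player B has no further information about the states, while in case (ii) Player B additionally observes the entire state sequence $S^n$. An average payoff $P$ is achievable at rate $R$ if for large enough block length $n$ there is such a rate-$R$ protocol for the helper and Player A guaranteeing Player A an expected per-iteration average payoff of (arbitrarily close to) at least $P$ against every strategy of Player B. Notation. For a conditional distribution $p_{A|S}$, and for $p_{U|S},p_{A|U}$ with joint distribution $p_S p_{U|S} p_{A|U}$ (with induced $p_U$, $p_{S|U}$, and $p_{A|S}(a|s)=\sum_u p_{U|S}(u|s)p_{A|U}(a|u)$), define \[\underline{\Pi}_{p_{A|S}} = \min_{p_B}\sum_{a,b,s} p_S(s)p_{A|S}(a|s)p_B(b)\Pi(a,b,s),\] \[\underline{\Pi}_{p_{A|S}}^{(S)} = \min_{p_{B|S}}\sum_{a,b,s} p_S(s)p_{A|S}(a|s)p_{B|S}(b|s)\Pi(a,b,s),\] \[\underline{\Pi}_{p_{A|U}}^{(U)}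 = \min_{p_{B|U}}\sum_{a,b,s,u} p_U(u)p_{S|U}(s|u)p_{A|U}(a|u)p_{B|U}(b|u)\Pi(a,b,s),\] \[\underline{\Pi}_{p_{A|U}}^{(S,U)} = \min_{p_{B|S,U}}\sum_{a,b,s,u} p_U(u)p_{S|U}(s|u)p_{A|U}(a|u)p_{B|S,U}(b|s,u)\Pi(a,b,s),\] i.e. the minimum expected payoff to Player A when Player B knows nothing, knows $S$, knows $U$, or knows $(S,U)$ respectively. $I(\cdot;\cdot)$ denotes mutual information (in bits) and $I(\cdot;\cdot|\cdot)$ conditional mutual information under this joint distribution; $(x)^+=\max(x,0)$. *)

(* Defs.v *)
From HB Require Import structures.
From mathcomp Require Import all_boot all_order all_algebra.
From mathcomp Require Import all_classical all_reals all_analysis.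

Set Implicit Arguments.
Unset Strict Implicit.
Unset Printing Implicit Defensive.

Import Order.TTheory GRing.Theory Num.Theory.
Local Open Scope ring_scope.
Local Open Scope classical_set_scope.

Section InfoTheory.
Variable R : realType.

Definition is_dist (T : finType) (p : T -> R) : Prop :=
  (forall t, 0 <= p t) /\ \sum_(t : T) p t = 1.

Definition log2 (x : R) : R := ln x / ln 2.

(** mutual information I(X;Y) in bits of a joint pmf pXY (0 log 0 = 0) *)
Definition mutinf (X Y : finType) (pXY : X -> Y -> R) : R :=
  \sum_(x : X) \sum_(y : Y)
    pXY x y * log2 (pXY x y /
      ((\sum_(y' : Y) pXY x y') * (\sum_(x' : X) pXY x' y))).

Definition cmutinf (X Y Z : finType) (p : X -> Y -> Z -> R) : R :=
  \sum_(x : X) \sum_(y : Y) \sum_(z : Z)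
    p x y z * log2 (p x y z * (\sum_(x' : X) \sum_(y' : Y) p x' y' z) /
      ((\sum_(y' : Y) p x y' z) * (\sum_(x' : X) p x' y z))).
End InfoTheory.

Section Game.
Variables (R : realType) (S A B : finType) (pS : S -> R) (Pi : A -> B -> S -> R).

Definition joint (U : finType) (pUS : S -> U -> R) (pAU : U -> A -> R)
  (s : S) (u : U) (a : A) : R := pS s * pUS s u * pAU u a.

Definition pA_S (U : finType) (pUS : S -> U -> R) (pAU : U -> A -> R)
  (s : S) (a : A) : R := \sum_(u : U) pUS s u * pAU u a.

Definition lowval (pAS : S -> A -> R) : R :=
  inf [set x | exists2 pB : B -> R, is_dist pB &
     x = \sum_(a : A) \sum_(b : B) \sum_(s : S) pS s * pAS s a * pB b * Pi a b s].

Definition lowval_S (pAS : S -> A -> R) : R :=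
  inf [set x | exists2 pBS : S -> B -> R, (forall s, is_dist (pBS s)) &
     x = \sum_(a : A) \sum_(b : B) \sum_(s : S) pS s * pAS s a * pBS s b * Pi a b s].

(** underline Pi^{(U)}_{p_{A|U}} : Player B knows U.
    p_U(u) p_{S|U}(s|u) is written as the joint p_S(s) p_{U|S}(u|s). *)
Definition lowval_U (U : finType) (pUS : S -> U -> R) (pAU : U -> A -> R) : R :=
  inf [set x | exists2 pBU : U -> B -> R, (forall u, is_dist (pBU u)) &
     x = \sum_(a : A) \sum_(b : B) \sum_(s : S) \sum_(u : U)
           pS s * pUS s u * pAU u a * pBU u b * Pi a b s].

Definition lowval_SU (U : finType) (pUS : S -> U -> R) (pAU : U -> A -> R) : R :=
  inf [set x | exists2 pBSU : S -> U -> B -> R,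
                 (forall s u, is_dist (pBSU s u)) &
     x = \sum_(a : A) \sum_(b : B) \sum_(s : S) \sum_(u : U)
           pS s * pUS s u * pAU u a * pBSU s u b * Pi a b s].

(** history available at iteration i: the past (a_j, b_j, s_j), j < i;
    future entries are masked by None *)
Definition hist (n : nat) := {ffun 'I_n -> option (A * B * S)}.

Definition hist_of (n : nat) (a : {ffun 'I_n -> A}) (b : {ffun 'I_n -> B})
  (s : {ffun 'I_n -> S}) (i : 'I_n) : hist n :=
  [ffun j : 'I_n => if (j < i)%N then Some (a j, b j, s j) else None].

(** expected per-iteration average payoff to Player A.
    enc  : randomized helper encoder p(m | s^n), m in 'I_K
    sA   : Player A's behavioural strategy p(a_i | i, m, history)
    sB   : Player B's behavioural strategy p(b_i | i, s^n, history) *)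
Definition exp_avg_payoff (n K : nat)
  (enc : {ffun 'I_n -> S} -> 'I_K -> R)
  (sA : 'I_n -> 'I_K -> hist n -> A -> R)
  (sB : 'I_n -> {ffun 'I_n -> S} -> hist n -> B -> R) : R :=
  \sum_(s : {ffun 'I_n -> S}) \sum_(m : 'I_K)
  \sum_(a : {ffun 'I_n -> A}) \sum_(b : {ffun 'I_n -> B})
    (\prod_(i : 'I_n) pS (s i)) * enc s m *
    (\prod_(i : 'I_n) (sA i m (hist_of a b s i) (a i) *
                       sB i s (hist_of a b s i) (b i))) *
    ((n%:R)^-1 * \sum_(i : 'I_n) Pi (a i) (b i) (s i)).

(** Achievability of average payoff P at rate Rt.
    B_knows_states = false : case (i), Player B's strategy may not depend on
    the (future/current) states beyond the past states in the history;
    B_knows_states = true : case (ii), Player B sees the whole s^n. *)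
Definition achievable (B_knows_states : bool) (Rt P : R) : Prop :=
  forall eps : R, 0 < eps ->
  exists N : nat, forall n : nat, (N <= n)%N ->
  exists (K : nat) (enc : {ffun 'I_n -> S} -> 'I_K -> R)
         (sA : 'I_n -> 'I_K -> hist n -> A -> R),
    [/\ (K%:R <= 2 `^ (n%:R * Rt)),
        (forall s, is_dist (enc s)),
        (forall i m h, is_dist (sA i m h)) &
        (forall sB : 'I_n -> {ffun 'I_n -> S} -> hist n -> B -> R,
           (forall i s h, is_dist (sB i s h)) ->
           (~~ B_knows_states -> forall i s s' h, sB i s h = sB i s' h) ->
           P - eps <= exp_avg_payoff enc sA sB)].
End Game.

(* Main.v *)
(** Random coding with a likelihood encoder.  Draw [K] codewords i.i.d. from
    [p_U ^ n]; the helper, seeing [s^n], sends [m] with probability proportional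
    to [prod_j p_{S|U}(s_j | u_j(m))], and Player A plays [p_{A|U}( . | u_i(m))]
    in round [i].  Soft covering at rate above [I(U;S)] makes the true joint law
    close in total variation to the one where [m] is uniform and the states come
    out of the channel [p_{S|U}].  Soft covering again shows that, while the
    channel outputs revealed to Player B carry less than [n R] bits about the
    codeword, the first [k = floor (theta n)] rounds look to Player B like i.i.d.
    pairs of law [p_S p_{A|S}]; each of them pays the value against an opponent
    ignorant of [U].  In the other rounds the message is treated as known and,
    on average over the codebook, each pays the value against an opponent who
    knows [U].  Taking [theta] such that the time average is [P] gives the rates. *)

Require Import Defs.
From HB Require Import structures.
From mathcomp Require Import all_boot all_order all_algebra.
From mathcomp Require Import all_classical all_reals all_analysis.
From mathcomp Require Import ring lra.
Import Order.TTheory GRing.Theory Num.Theory.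
Local Open Scope ring_scope.

(** * Soft covering, one shot *)

Lemma dist_inhabited (R : realType) (T : finType) (p : T -> R) :
  is_dist p -> inhabited T.
Proof.
move=> [_ p1]; have [t _|no] := pickP (@predT T); first by split.
move: p1; rewrite big1 => [/eqP|t]; last by have := no t.
by rewrite eq_sym oner_eq0.
Qed.

Section ProductDistributions.
Context {R : realType}.

Lemma sum_ffun_prod (I J : finType) (F : I -> J -> R) :
  \sum_(f : {ffun I -> J}) \prod_i F i (f i) = \prod_i \sum_j F i j.
Proof. by rewrite bigA_distr_bigA. Qed.

Lemma prod_dist (I J : finType) (p : I -> J -> R) :
  (forall i, is_dist (p i)) ->
  is_dist (fun f : {ffun I -> J} => \prod_i p i (f i)).
Proof.
move=> hp; split=> [f|]; first by apply: prodr_ge0 => i _; case: (hp i).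
by rewrite sum_ffun_prod big1 // => i _; case: (hp i).
Qed.

Lemma sum_prod_marginal (I J : finType) (p : I -> J -> R) (i0 : I) (g : J -> R) :
  (forall i, is_dist (p i)) ->
  \sum_(f : {ffun I -> J}) (\prod_i p i (f i)) * g (f i0) =
  \sum_j p i0 j * g j.
Proof.
move=> hp.
transitivity (\sum_(f : {ffun I -> J})
    \prod_i (p i (f i) * (if i == i0 then g (f i) else 1))).
  apply: eq_bigr => f _; rewrite big_split /=; congr (_ * _).
  by rewrite -big_mkcond big_pred1_eq.
rewrite (sum_ffun_prod _ _ (fun i j => p i j * (if i == i0 then g j else 1))).
rewrite (bigD1 i0) //= eqxx [X in _ * X]big1 ?mulr1 // => i /negbTE ->.
by under eq_bigr do rewrite mulr1; case: (hp i).
Qed.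

Lemma sum_prod_marginal2 (I J : finType) (p : I -> J -> R) (i1 i2 : I)
    (g h : J -> R) : (forall i, is_dist (p i)) -> i1 != i2 ->
  \sum_(f : {ffun I -> J}) (\prod_i p i (f i)) * (g (f i1) * h (f i2)) =
  (\sum_j p i1 j * g j) * (\sum_j p i2 j * h j).
Proof.
move=> hp ne12.
transitivity (\sum_(f : {ffun I -> J})
    \prod_i (p i (f i) * ((if i == i1 then g (f i) else 1) *
                          (if i == i2 then h (f i) else 1)))).
  apply: eq_bigr => f _; rewrite !big_split /=; congr (_ * (_ * _)).
  - by rewrite -big_mkcond big_pred1_eq.
  - by rewrite -big_mkcond big_pred1_eq.
rewrite (sum_ffun_prod _ _ (fun i j => p i j * ((if i == i1 then g j else 1) *
                          (if i == i2 then h j else 1)))).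
rewrite (bigD1 i1) //= (bigD1 i2) /=; last by rewrite eq_sym.
rewrite !eqxx (negbTE ne12) eq_sym (negbTE ne12) mulrA.
rewrite [X in _ * X]big1 ?mulr1; last first.
  move=> i /andP[/negbTE -> /negbTE ->].
  by under eq_bigr do rewrite !mulr1; case: (hp i).
by congr (_ * _); apply: eq_bigr => j _; rewrite ?mulr1 ?mul1r.
Qed.

(** Independence factors the cross terms into products of means, which vanish; the [K] diagonal
    terms remain. *)
Lemma second_moment_iid (K : nat) (V : finType) (q f : V -> R) :
  is_dist q -> \sum_v q v * f v = 0 ->
  \sum_(c : {ffun 'I_K -> V}) (\prod_m q (c m)) * (\sum_m f (c m)) ^+ 2 =
  K%:R * \sum_v q v * f v ^+ 2.
Proof.
move=> hq f0.
transitivity (\sum_(m < K) \sum_(m' < K) \sum_(c : {ffun 'I_K -> V})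
    (\prod_i q (c i)) * (f (c m) * f (c m'))).
  under [RHS]eq_bigr do rewrite exchange_big /=.
  rewrite exchange_big /=; apply: eq_bigr => c _.
  rewrite expr2 mulr_suml mulr_sumr; apply: eq_bigr => m _.
  by rewrite mulr_sumr mulr_sumr.
transitivity (\sum_(m < K) \sum_v q v * f v ^+ 2).
  apply: eq_bigr => m _; rewrite (bigD1 m) //= [X in _ + X]big1 ?addr0.
    by apply: (sum_prod_marginal _ _ (fun=> q) m (fun v => f v * f v)).
  move=> m' ne; rewrite (sum_prod_marginal2 _ _ (fun=> q)) // 1?eq_sym //.
  by rewrite f0 mul0r.
by rewrite sumr_const card_ord mulr_natl.
Qed.

Lemma exists_gt_of_mean (T : finType) (p f : T -> R) (y : R) :
  is_dist p -> y < \sum_t p t * f t -> exists t, y < f t.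
Proof.
move=> [p0 p1] hy; apply: contrapT => /forallNP hn.
suff : \sum_t p t * f t <= y by lra.
rewrite -[leRHS]mul1r -p1 mulr_suml; apply: ler_sum => t _.
by rewrite ler_wpM2l //; have /negP := hn t; rewrite -leNgt.
Qed.

(* Truncate [g] at [T mu]: the bounded part has variance at most [T mu ^ 2 / K],
   the remainder is small in mean. *)
Lemma iid_mean_deviation (K : nat) (V : finType) (q g : V -> R) (T e mu : R) :
  is_dist q -> (forall v, 0 <= g v) -> (0 < K)%N -> 0 <= T -> 0 < e ->
  mu = \sum_v q v * g v ->
  \sum_(c : {ffun 'I_K -> V}) (\prod_m q (c m)) *
     `|K%:R^-1 * \sum_m g (c m) - mu| <=
  mu * (T / (e * K%:R) + e) + 2 * \sum_v q v * g v * (T * mu < g v)%R%:R.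
Proof.
move=> hq g0 K0 T0 e0 muq; have [q0 q1] := hq.
have mu0 : 0 <= mu by rewrite muq; apply: sumr_ge0 => v _; rewrite mulr_ge0.
have KR : 0 < K%:R :> R by rewrite ltr0n.
pose pc (c : {ffun 'I_K -> V}) := \prod_m q (c m).
have [pc0 pc1] : is_dist pc by exact: (prod_dist _ _ (fun=> q)).
have mean (h : V -> R) :
    \sum_c pc c * (K%:R^-1 * \sum_m h (c m)) = \sum_v q v * h v.
  under eq_bigr do rewrite mulrCA mulr_sumr.
  rewrite -mulr_sumr exchange_big /=.
  under eq_bigr => m _ do
    rewrite (sum_prod_marginal _ _ (fun=> q) m h) //.
  by rewrite sumr_const card_ord -[X in _ * X]mulr_natl mulKf // gt_eqF.
pose g2 v := g v * (T * mu < g v)%R%:R.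
pose g1 v := g v - g2 v.
have g20 v : 0 <= g2 v by rewrite mulr_ge0 // ler0n.
have g10 v : 0 <= g1 v.
  by rewrite /g1 /g2; case: ltP => _ /=; rewrite ?mulr1 ?mulr0 ?subrr ?subr0.
have g1T v : g1 v <= T * mu.
  rewrite /g1 /g2; case: ltP => /= h; rewrite ?mulr1 ?mulr0 ?subrr ?subr0 //.
  by rewrite mulr_ge0.
pose mu1 := \sum_v q v * g1 v; pose mu2 := \sum_v q v * g2 v.
have muE : mu = mu1 + mu2.
  rewrite muq /mu1 /mu2 -big_split /=; apply: eq_bigr => v _.
  by rewrite /g1 -mulrDr subrK.
have mu10 : 0 <= mu1 by apply: sumr_ge0 => v _; rewrite mulr_ge0.
have mu20 : 0 <= mu2 by apply: sumr_ge0 => v _; rewrite mulr_ge0.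
have -> : \sum_v q v * g v * (T * mu < g v)%R%:R = mu2.
  by apply: eq_bigr => v _; rewrite /g2 mulrA.
(* The general bound divides by [mu]. If [mu = 0], the empirical mean is nonnegative with
   expectation zero, so the left side vanishes. *)
have [mz|mnz] := eqVneq mu 0.
  rewrite mz mul0r add0r; apply: (@le_trans _ _ 0); last by rewrite mulr_ge0.
  rewrite -[leRHS]mz muq -mean.
  apply: ler_sum => c _; rewrite subr0 ger0_norm // mulr_ge0 ?invr_ge0 ?(ltW KR) //.
  by apply: sumr_ge0.
have mup : 0 < mu by rewrite lt0r mnz.
pose f v := g1 v - mu1.
have f0 : \sum_v q v * f v = 0.
  rewrite /f; under eq_bigr do rewrite mulrBr.
  by rewrite sumrB -mulr_suml q1 mul1r subrr.
have f2 : \sum_v q v * f v ^+ 2 <= T * mu ^+ 2.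
  apply: (@le_trans _ _ (\sum_v q v * g1 v ^+ 2)).
    have : \sum_v q v * f v ^+ 2 = \sum_v q v * g1 v ^+ 2 - mu1 ^+ 2.
      transitivity (\sum_v (q v * g1 v ^+ 2 + (- (2 * mu1) * (q v * g1 v)
                            + mu1 ^+ 2 * q v))).
        by apply: eq_bigr => v _; rewrite /f; ring.
      by rewrite !big_split /= -!mulr_sumr -/mu1 q1; ring.
    by move=> ->; rewrite lerBlDr lerDl sqr_ge0.
  apply: (@le_trans _ _ (T * mu * mu1)).
    rewrite /mu1 mulr_sumr; apply: ler_sum => v _.
    by rewrite [leRHS]mulrCA ler_wpM2l // expr2 ler_wpM2r.
  by rewrite expr2 mulrA ler_wpM2l // ?mulr_ge0 // muE lerDl.
(* The centred bounded part [Z] is handled by [|Z| <= Z ^ 2 / (e * mu) + e * mu]. The weight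
   [e * mu] makes both resulting terms proportional to [mu], so that they can later be summed over
   channel outputs. *)
have bnd (c : {ffun 'I_K -> V}) : `|K%:R^-1 * \sum_m g (c m) - mu| <=
    (K%:R^-1 ^+ 2 / (e * mu)) * (\sum_m f (c m)) ^+ 2 + e * mu +
    (K%:R^-1 * \sum_m g2 (c m) + mu2).
  have -> : K%:R^-1 * \sum_m g (c m) - mu = K%:R^-1 * \sum_m f (c m) +
     (K%:R^-1 * \sum_m g2 (c m) - mu2).
    have -> : \sum_m f (c m) = \sum_m g (c m) - \sum_m g2 (c m) - K%:R * mu1.
      rewrite /f /g1 !sumrB; congr (_ - _).
      by rewrite sumr_const card_ord mulr_natl.
    by rewrite !mulrBr mulKf ?gt_eqF // muE; ring.
  apply: (le_trans (ler_normD _ _)); apply: lerD; last first.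
    apply: (le_trans (ler_normB _ _)); rewrite (ger0_norm mu20) lerD2r.
    rewrite ger0_norm // mulr_ge0 ?invr_ge0 ?(ltW KR) //.
    exact: sumr_ge0.
  set X := \sum_m f (c m).
  set Z := K%:R^-1 * X.
  have -> : K%:R^-1 ^+ 2 / (e * mu) * X ^+ 2 = Z ^+ 2 / (e * mu).
    by rewrite /Z exprMn mulrAC.
  have a0 : 0 < e * mu by rewrite mulr_gt0.
  rewrite -(@ler_pM2r _ (e * mu)) // mulrDl mulfVK ?gt_eqF //.
  rewrite -(real_normK (num_real Z)) -expr2.
  by have := sqr_ge0 (`|Z| - e * mu); have := normr_ge0 Z; nra.
apply: (@le_trans _ _ (\sum_c pc c *
   ((K%:R^-1 ^+ 2 / (e * mu)) * (\sum_m f (c m)) ^+ 2 + e * mu +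
    (K%:R^-1 * \sum_m g2 (c m) + mu2)))).
  by apply: ler_sum => c _; rewrite -/(pc c) ler_wpM2l ?bnd //; exact: pc0.
under eq_bigr do rewrite 2!mulrDr.
rewrite !big_split /= -mulr_suml pc1 mul1r.
under [X in _ + X]eq_bigr do rewrite mulrDr.
rewrite big_split /= mean -/mu2 -mulr_suml pc1 mul1r.
under eq_bigr do rewrite mulrCA.
rewrite -mulr_sumr second_moment_iid //.
have -> : mu * (T / (e * K%:R) + e) + 2 * mu2 =
   K%:R^-1 ^+ 2 / (e * mu) * (K%:R * (T * mu ^+ 2)) + e * mu + (mu2 + mu2).
  by field; rewrite ?gt_eqF.
rewrite !lerD2r ler_wpM2l ?divr_ge0 ?exprn_ge0 ?invr_ge0 ?mulr_ge0 ?(ltW KR) ?(ltW e0) //.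
by rewrite ler_wpM2l // ltW.
Qed.

(** For each output [y] the numbers [W (c m) y] are i.i.d. with mean [r y], so [iid_mean_deviation]
    applies pointwise; the main term is proportional to [r y], and [r] has mass 1. The last sum is
    the probability that the likelihood ratio exceeds [T]. *)
Lemma soft_covering_one_shot (K : nat) (V Y : finType) (q : V -> R)
    (W : V -> Y -> R) (r : Y -> R) (T e : R) :
  is_dist q -> (forall v, is_dist (W v)) ->
  (forall y, r y = \sum_v q v * W v y) ->
  (0 < K)%N -> 0 <= T -> 0 < e ->
  \sum_(c : {ffun 'I_K -> V}) (\prod_m q (c m)) *
     \sum_y `|K%:R^-1 * \sum_m W (c m) y - r y| <=
  T / (e * K%:R) + e + 2 * \sum_v \sum_y q v * W v y * (T * r y < W v y)%R%:R.
Proof.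
move=> hq hW hr K0 T0 e0.
have r1 : \sum_y r y = 1.
  under eq_bigr do rewrite hr.
  rewrite exchange_big /= -[RHS](proj2 hq); apply: eq_bigr => v _.
  by rewrite -mulr_sumr (proj2 (hW v)) mulr1.
under eq_bigr do rewrite mulr_sumr.
rewrite exchange_big /= [X in _ <= _ + 2 * X]exchange_big /=.
have -> : T / (e * K%:R) + e = \sum_y r y * (T / (e * K%:R) + e).
  by rewrite -mulr_suml r1 mul1r.
rewrite mulr_sumr -big_split /=.
apply: ler_sum => y _.
by apply: iid_mean_deviation => // v; case: (hW v).
Qed.

End ProductDistributions.

(** * Soft covering for product channels *)

Section SoftCovering.
Context {R : realType}.

(** From [expR (- x) >= 1 - x] one gets [expR x * (1 - x) <= 1], while [(1 + x + 2 * x ^ 2) * (1 -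
    x) = 1 + x ^ 2 * (1 - 2 * x)] is at least 1. *)
Lemma expR_le_quadratic (x : R) : x <= 2^-1 -> expR x <= 1 + x + 2 * x ^+ 2.
Proof.
move=> hx; have h := expR_ge1Dx (- x); have e0 := expR_gt0 x.
have : expR x * (1 - x) <= 1.
  by rewrite -[leRHS](expRxMexpNx_1 x) ler_wpM2l // ltW.
have : (1 + x + 2 * x ^+ 2) * (1 - x) >= 1.
  by have := sqr_ge0 x; nra.
move=> h1 h2; rewrite -(@ler_pM2r _ (1 - x)); last lra.
exact: le_trans h1.
Qed.

Lemma expRN_small (a e : R) : 0 < a -> 0 < e ->
  exists N : nat, forall n : nat, (N <= n)%N -> expR (- (n%:R * a)) <= e.
Proof.
move=> a0 e0; pose N := (Num.trunc (e^-1 / a)).+1.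
exists N => n Nn; have eV : 0 < e^-1 by rewrite invr_gt0.
have h : e^-1 <= n%:R * a.
  rewrite -ler_pdivrMr //; apply: (@le_trans _ _ N%:R); last by rewrite ler_nat.
  exact/ltW/truncnS_gt.
rewrite expRN -[leRHS]invrK lef_pV2 ?posrE ?expR_gt0 //.
by have := expR_ge1Dx (n%:R * a); lra.
Qed.

(** Mutual information in nats when [r] is the output law of [W] under [q]. *)
Definition kl_info {U Y : finType} (q : U -> R) (r : Y -> R) (W : U -> Y -> R) : R :=
  \sum_u \sum_y q u * W u y * ln (W u y / r y).

Section Channel.
Context {U Y : finType} {q : U -> R} {r : Y -> R}.
Hypothesis hq : is_dist q.

(** The output law is prescribed, not derived, because several channels with one common output law
    will be used in different rounds of a block. *)
Definition channel_to (W : U -> Y -> R) : Prop :=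
  (forall u, is_dist (W u)) /\ (forall y, r y = \sum_u q u * W u y).

Lemma channel_output_dist W : channel_to W -> is_dist r.
Proof.
move=> [hW hr]; split=> [y|].
  rewrite hr; apply: sumr_ge0 => u _.
  by rewrite mulr_ge0 //; [case: hq | case: (hW u)].
under eq_bigr do rewrite hr.
rewrite exchange_big /= -[RHS](proj2 hq); apply: eq_bigr => v _.
by rewrite -mulr_sumr (proj2 (hW v)) mulr1.
Qed.

Lemma channel_output_gt0 W u y : channel_to W -> 0 < q u * W u y -> 0 < r y.
Proof.
move=> [hW hr] h; rewrite hr (bigD1 u) //=; apply: ltr_wpDr => //.
apply: sumr_ge0 => u' _.
by rewrite mulr_ge0 //; [case: hq | case: (hW u')].
Qed.

(** The inequality [ln z >= 1 - z^-1], applied termwise, bounds the sum below by the difference of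
    two total masses. *)
Lemma kl_info_ge0 W : channel_to W -> 0 <= kl_info q r W.
Proof.
move=> hc; have [r0 r1] := channel_output_dist _ hc; have [hW hr] := (hc).
have [q0 q1] := hq.
have : \sum_u \sum_y (q u * W u y - q u * r y) <= kl_info q r W.
  apply: ler_sum => u _; apply: ler_sum => y _.
  have W0 : 0 <= W u y by case: (hW u).
  have qW0 : 0 <= q u * W u y by rewrite mulr_ge0.
  have [z|nz] := eqVneq (q u * W u y) 0.
    by rewrite z mul0r sub0r oppr_le0 mulr_ge0.
  have p : 0 < q u * W u y by rewrite lt0r nz.
  have rp := channel_output_gt0 _ _ _ hc p.
  have Wp : 0 < W u y.
    by rewrite lt0r W0 andbT; apply: contra_neq nz => ->; rewrite mulr0.
  have -> : q u * W u y - q u * r y = q u * W u y * (1 - (W u y / r y)^-1).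
    by rewrite invf_div; field; rewrite gt_eqF.
  rewrite ler_wpM2l //; set z := W u y / r y.
  have zp : 0 < z by rewrite divr_gt0.
  have := expR_ge1Dx (- ln z); rewrite expRN lnK ?posrE //; lra.
move=> /(le_trans _); apply.
have -> : \sum_u \sum_y (q u * W u y - q u * r y) = 0; last by [].
under eq_bigr do rewrite sumrB -!mulr_sumr r1 mulr1.
under eq_bigr => u _ do rewrite (proj2 (hW u)) mulr1 subrr.
by rewrite big1.
Qed.

(** Expand the exponential to second order, using that the information density is bounded by [L],
    and close with [1 + x <= expR x]. *)
Lemma channel_mgf_le W (L lam : R) : channel_to W ->
  (forall u y, `|ln (W u y / r y)| <= L) -> 0 <= lam -> lam * L <= 2^-1 ->
  \sum_u \sum_y q u * W u y * expR (lam * ln (W u y / r y)) <=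
  expR (lam * kl_info q r W + 2 * (lam * L) ^+ 2).
Proof.
move=> hc hL lam0 hlam; have [hW hr] := (hc); have [q0 q1] := hq.
apply: le_trans (expR_ge1Dx _).
have -> : 1 + (lam * kl_info q r W + 2 * (lam * L) ^+ 2) =
  \sum_u \sum_y q u * W u y *
      (1 + lam * ln (W u y / r y) + 2 * (lam * L) ^+ 2).
  have one : \sum_u \sum_y q u * W u y = 1.
    rewrite -[RHS]q1; apply: eq_bigr => u _.
    by rewrite -mulr_sumr (proj2 (hW u)) mulr1.
  transitivity (\sum_u \sum_y (q u * W u y * (1 + 2 * (lam * L) ^+ 2) +
     lam * (q u * W u y * ln (W u y / r y)))).
    rewrite pair_bigA big_split /= -mulr_suml -[X in _ = _ + X]mulr_sumr.
    rewrite -(pair_bigA _ (fun u y => q u * W u y)) /= one.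
    rewrite -(pair_bigA _ (fun u y => q u * W u y * ln (W u y / r y))) /=.
    by rewrite -/(kl_info q r W); ring.
  by apply: eq_bigr => u _; apply: eq_bigr => y _; ring.
apply: ler_sum => u _; apply: ler_sum => y _.
rewrite ler_wpM2l ?mulr_ge0 //; first by case: (hW u).
set l := ln _.
have a : `|lam * l| <= lam * L by rewrite normrM ger0_norm // ler_wpM2l // hL.
have b := ler_norm (lam * l).
apply: (le_trans (expR_le_quadratic _ _)); first lra.
rewrite lerD2l ler_wpM2l // -real_normK ?num_real //.
by rewrite ler_sqr ?nnegrE // (le_trans _ a).
Qed.

(* Chernoff bound with parameter [lam]. *)
Lemma info_density_tail (n : nat) (W : 'I_n -> U -> Y -> R) (L lam t : R) :
  (forall j, channel_to (W j)) ->
  (forall j u y, `|ln (W j u y / r y)| <= L) -> 0 <= lam -> lam * L <= 2^-1 ->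
  \sum_(v : {ffun 'I_n -> U}) \sum_(y : {ffun 'I_n -> Y})
    (\prod_j q (v j)) * (\prod_j W j (v j) (y j)) *
    (expR t * (\prod_j r (y j)) < \prod_j W j (v j) (y j))%R%:R <=
  expR (lam * (\sum_j kl_info q r (W j) - t) + n%:R * (2 * (lam * L) ^+ 2)).
Proof.
move=> hc hL lam0 hlam; have [q0 q1] := hq.
have W0 j u y : 0 <= W j u y by have [hW _] := hc j; case: (hW u).
apply: (@le_trans _ _ (\sum_(v : {ffun 'I_n -> U}) \sum_(y : {ffun 'I_n -> Y})
   expR (- (lam * t)) * \prod_j (q (v j) * W j (v j) (y j) *
      expR (lam * ln (W j (v j) (y j) / r (y j)))))).
  apply: ler_sum => v _; apply: ler_sum => y _.
  rewrite -big_split /= [X in _ <= _ * X]big_split /= -expR_sum mulrCA -expRD.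
  have p0 : 0 <= \prod_i (q (v i) * W i (v i) (y i)).
    by apply: prodr_ge0 => i _; rewrite mulr_ge0.
  (* Off the support of the joint law both sides vanish; on it every factor is positive, so the
     logarithms are genuine. *)
  have [z|nz] := eqVneq (\prod_i (q (v i) * W i (v i) (y i))) 0.
    by rewrite z !mul0r.
  rewrite ler_wpM2l //; case: ltP => h; last by rewrite expR_ge0.
  have pj j : 0 < q (v j) * W j (v j) (y j).
    rewrite lt0r mulr_ge0 // andbT; apply: contra_neq nz => z.
    by rewrite (bigD1 j) //= z mul0r.
  have rj j : 0 < r (y j) by apply: channel_output_gt0 (pj j).
  have Wj j : 0 < W j (v j) (y j).
    rewrite lt0r W0 andbT; apply/negP => /eqP z.
    by have := pj j; rewrite z mulr0 ltxx.
  rewrite -mulr_sumr addrC -mulrBr.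
  apply: (le_trans _ (expR_ge1Dx _)); rewrite lerDl mulr_ge0 // subr_ge0.
  rewrite -ler_expR expR_sum ltW //.
  have -> : \prod_i expR (ln (W i (v i) (y i) / r (y i))) =
       (\prod_i W i (v i) (y i)) / \prod_i r (y i).
    rewrite -prodf_div; apply: eq_bigr => i _.
    by rewrite lnK // posrE divr_gt0.
  by rewrite ltr_pdivlMr // prodr_gt0.
under eq_bigr do rewrite -mulr_sumr.
rewrite -mulr_sumr.
have -> : \sum_(v : {ffun 'I_n -> U}) \sum_(y : {ffun 'I_n -> Y})
    \prod_j (q (v j) * W j (v j) (y j) *
      expR (lam * ln (W j (v j) (y j) / r (y j)))) =
   \prod_j \sum_u \sum_y q u * W j u y * expR (lam * ln (W j u y / r y)).
  rewrite -(sum_ffun_prod _ _ (fun j u => \sum_y _)); apply: eq_bigr => v _.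
  by rewrite -(sum_ffun_prod _ _ (fun j y => _ )).
apply: (@le_trans _ _ (expR (- (lam * t)) *
   \prod_j expR (lam * kl_info q r (W j) + 2 * (lam * L) ^+ 2))).
  rewrite ler_wpM2l ?expR_ge0 //; apply: ler_prod => j _.
  rewrite channel_mgf_le // andbT; apply: sumr_ge0 => u _; apply: sumr_ge0 => y _.
  by rewrite !mulr_ge0 ?expR_ge0.
rewrite -expR_sum -expRD ler_expR big_split /= -mulr_sumr sumr_const card_ord.
by rewrite -mulr_natl; rewrite le_eqVlt; apply/orP; left; apply/eqP; ring.
Qed.

End Channel.

(** The one-shot bound is used at a threshold [expR t] with [t / n] strictly between [rho'] and
    [rho]: the tail is exponentially small by Chernoff, and [K] exceeds the threshold by an
    exponential factor. [N] is uniform in [K] and in the schedule [sel] of the two channels; the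
    factor 2 absorbs the rounding of [K] to an integer. *)
Lemma soft_covering (U Y : finType) (q : U -> R) (r : Y -> R)
    (W : bool -> U -> Y -> R) (rho rho' e : R) :
  is_dist q -> (forall b, @channel_to U Y q r (W b)) -> rho' < rho -> 0 < e ->
  exists N : nat, forall n : nat, (N <= n)%N ->
  forall (K : nat) (sel : 'I_n -> bool), (0 < K)%N ->
    expR (n%:R * rho) <= 2 * K%:R ->
    \sum_j kl_info q r (W (sel j)) <= n%:R * rho' ->
  \sum_(c : {ffun 'I_K -> {ffun 'I_n -> U}}) (\prod_m \prod_j q (c m j)) *
    \sum_(y : {ffun 'I_n -> Y})
      `|K%:R^-1 * (\sum_m \prod_j W (sel j) (c m j) (y j)) - \prod_j r (y j)|
  <= e.
Proof.
move=> hq hc hrho e0.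
pose L := 1 + \sum_b \sum_u \sum_y `|ln (W b u y / r y)|.
have L1 : 1 <= L by rewrite lerDl; do 3 (apply: sumr_ge0 => ? _).
have hL b u y : `|ln (W b u y / r y)| <= L.
  apply: (@le_trans _ _ (\sum_b \sum_u \sum_y `|ln (W b u y / r y)|)); last first.
    by rewrite /L lerDr.
  rewrite (bigD1 b) //= (bigD1 u) //= (bigD1 y) //= -!addrA lerDl.
  by rewrite !addr_ge0 //; do ?(apply: sumr_ge0 => ? _).
(* Half of the rate gap, so that the threshold rate [rho' + d] stays [d] below [rho]; the cap at 1
   keeps [lam * L] below one half. *)
pose d := Num.min ((rho - rho') / 2) 1.
have d0 : 0 < d by rewrite lt_min ltr01 andbT divr_gt0 // subr_gt0.
have d1 : d <= 1 by rewrite ge_min lexx orbT.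
have dr : rho' + 2 * d <= rho.
  have : d <= (rho - rho') / 2 by rewrite ge_min lexx.
  by lra.
(* This value minimises the exponent per round [- lam * d + 2 * (lam * L) ^ 2]; the minimum is [- a]
   with [a] as below. *)
pose lam := d / (4 * L ^+ 2).
have L0 : 0 < L by lra.
have lam0 : 0 <= lam by rewrite divr_ge0 ?mulr_ge0 ?exprn_ge0 ?ltW.
have lamL : lam * L = d / (4 * L) by rewrite /lam; field; rewrite gt_eqF.
have lamLle : lam * L <= 2^-1.
  rewrite lamL ler_pdivrMr; last lra.
  by lra.
pose a := d ^+ 2 / (8 * L ^+ 2).
have a0 : 0 < a by rewrite divr_gt0 ?mulr_gt0 ?exprn_gt0.
have e3 : 0 < e / 3 by rewrite divr_gt0.
have e6 : 0 < e / 6 by rewrite divr_gt0.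
have [N1 hN1] := expRN_small a (e / 6) a0 e6.
(* This tolerance is what turns [expR t <= expR (- (n%:R * d)) * (2 * K%:R)] into
   [expR t <= (e / 3) ^ 2 * K%:R]. *)
have [N2 hN2] := expRN_small d ((e / 3) ^+ 2 / 2) d0 (divr_gt0 (exprn_gt0 2 e3) (ltr0Sn R 1)).
exists (maxn N1 N2) => n; rewrite geq_max => /andP[n1 n2] K sel K0 hK hI.
have KR : 0 < K%:R :> R by rewrite ltr0n.
pose t := n%:R * (rho' + d).
have := @soft_covering_one_shot R K _ _ (fun v : {ffun 'I_n -> U} => \prod_j q (v j))
  (fun v (y : {ffun 'I_n -> Y}) => \prod_j W (sel j) (v j) (y j))
  (fun y => \prod_j r (y j)) (expR t) (e / 3)
  (prod_dist _ _ (fun=> q) (fun=> hq))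
  (fun v => prod_dist _ _ (fun j => W (sel j) (v j)) (fun j => proj1 (hc (sel j)) (v j))).
move=> /(_ _ K0 (expR_ge0 _) e3) H; apply: (le_trans (H _)) => {H}.
  move=> y; transitivity (\sum_(v : {ffun 'I_n -> U})
      \prod_j (q (v j) * W (sel j) (v j) (y j))).
    rewrite (sum_ffun_prod _ _ (fun j u => q u * W (sel j) u (y j))).
    by apply: eq_bigr => j _; case: (hc (sel j)) => _ ->.
  by apply: eq_bigr => v _; rewrite big_split.
have H1 := info_density_tail hq n (fun j => W (sel j)) L lam t
  (fun j => hc (sel j)) (fun j => hL (sel j)) lam0 lamLle.
have H2 : expR (lam * (\sum_j kl_info q r (W (sel j)) - t) +
     n%:R * (2 * (lam * L) ^+ 2)) <= e / 6.
  apply: le_trans (hN1 n n1); rewrite ler_expR.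
  apply: (@le_trans _ _ (lam * (n%:R * rho' - t) + n%:R * (2 * (lam * L) ^+ 2))).
    by rewrite lerD2r ler_wpM2l // lerB.
  by rewrite /t lamL /lam /a; rewrite le_eqVlt; apply/orP; left; apply/eqP; field; rewrite gt_eqF.
have H3 : expR t / (e / 3 * K%:R) <= e / 3.
  rewrite ler_pdivrMr ?mulr_gt0 //.
  have := hN2 n n2.
  have E : expR t = expR (- (n%:R * d)) * expR (n%:R * (rho' + 2 * d)).
    by rewrite -expRD /t; congr expR; ring.
  have F : expR (n%:R * (rho' + 2 * d)) <= 2 * K%:R.
    by apply: le_trans hK; rewrite ler_expR ler_wpM2l.
  rewrite E => G.
  apply: (@le_trans _ _ ((e / 3) ^+ 2 / 2 * (2 * K%:R))).
    by apply: ler_pM; rewrite ?expR_ge0.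
  by rewrite le_eqVlt; apply/orP; left; apply/eqP; field.
have := le_trans H1 H2; lra.
Qed.

End SoftCovering.

(** * Causal kernels *)

Section CausalKernels.
Context {R : realType} {n : nat} {X : finType}.
Implicit Types (x : {ffun 'I_n -> X}) (k : 'I_n -> {ffun 'I_n -> X} -> X -> R).

Definition upd (t : 'I_n) (y : X) x : {ffun 'I_n -> X} :=
  [ffun j => if j == t then y else x j].

(** Exchanging coordinate [t] with a spare letter is an involution on pairs of a sequence and a
    letter. Resampling one coordinate in this way avoids splitting sequences into past, present and
    future. *)
Lemma sum_resample (t : 'I_n) (H : {ffun 'I_n -> X} -> R) :
  #|X|%:R * \sum_x H x = \sum_x \sum_y H (upd t y x).
Proof.
rewrite [RHS]pair_bigA /=.
pose phi (z : {ffun 'I_n -> X} * X) := (upd t z.2 z.1, z.1 t).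
have phiK : involutive phi.
  move=> [x y]; rewrite /phi /=; congr pair; last by rewrite ffunE eqxx.
  by apply/ffunP => j; rewrite !ffunE; case: eqP => [->|].
rewrite (reindex_inj (inv_inj phiK)) /=.
transitivity (\sum_(z : {ffun 'I_n -> X} * X) H z.1).
  rewrite -(pair_bigA _ (fun x (_ : X) => H x)) /= mulr_sumr.
  by apply: eq_bigr => x _; rewrite sumr_const mulr_natl.
by apply: eq_bigr => z _; congr H; have := phiK z => /(congr1 fst).
Qed.

Definition prefix_fun {T : Type} (t : nat) (f : {ffun 'I_n -> X} -> T) : Prop :=
  forall x x', (forall j : 'I_n, (j < t)%N -> x j = x' j) -> f x = f x'.

Definition causal k : Prop :=
  (forall j x, is_dist (k j x)) /\ (forall j : 'I_n, prefix_fun j (k j)).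

Lemma prefix_fun_upd {T : Type} (t : 'I_n) (i : nat) (f : {ffun 'I_n -> X} -> T) x y :
  (i <= t)%N -> prefix_fun i f -> f (upd t y x) = f x.
Proof.
move=> it hf; apply: hf => j jt; rewrite ffunE; case: eqP => // jE.
by move: jt; rewrite jE ltnNge it.
Qed.

Let c : R := #|X|%:R^-1.

Lemma causal_card_gt0 k (i : 'I_n) x : causal k -> (0 < #|X|)%N.
Proof.
move=> [hk _].
have [y] := dist_inhabited _ _ _ (hk i x).
by apply/card_gt0P; exists y.
Qed.

(** [G] collects the factors that ignore coordinate [t]. After resampling, that coordinate carries
    the uniform weight [c] and the kernel acts as a conditional expectation on [h]. *)
Lemma resample_kernel k (t : 'I_n) (G h : {ffun 'I_n -> X} -> R) :
  causal k -> (forall x y, G (upd t y x) = G x) ->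
  \sum_x k t x (x t) * G x * h x =
  \sum_x c * G x * \sum_y k t x y * h (upd t y x).
Proof.
move=> hk hG.
have [x0|no] := pickP (@predT {ffun 'I_n -> X}); last first.
  by rewrite !big1 // => x; have := no x.
have X0 : #|X|%:R != 0 :> R.
  by rewrite pnatr_eq0 -lt0n (causal_card_gt0 _ t x0 hk).
move=> _; apply: (mulfI X0); rewrite (sum_resample t) mulr_sumr.
apply: eq_bigr => x _; rewrite mulr_sumr mulr_sumr; apply: eq_bigr => y _.
rewrite hG ffunE eqxx (prefix_fun_upd t t) //; last by case: hk.
by rewrite /c; field.
Qed.

(* Factors from round [t] on are replaced by the uniform law, which lets the
   future be summed out without leaving [{ffun 'I_n -> X}]. *)
Definition trunc_prob k (t : nat) x : R :=
  \prod_(j < n) (if (j < t)%N then k j x (x j) else c).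

Lemma trunc_probD1 k (t : 'I_n) x :
  trunc_prob k t.+1 x = k t x (x t) *
    \prod_(j < n | j != t) (if (j < t)%N then k j x (x j) else c).
Proof.
rewrite /trunc_prob (bigD1 t) //= ltnSn; congr (_ * _).
by apply: eq_bigr => j /negbTE jt; rewrite ltnS leq_eqVlt [_ == _ :> nat]jt.
Qed.

Lemma trunc_prob_upd k (t : 'I_n) x y : causal k ->
  \prod_(j < n | j != t) (if (j < t)%N then k j (upd t y x) (upd t y x j) else c) =
  \prod_(j < n | j != t) (if (j < t)%N then k j x (x j) else c).
Proof.
move=> [_ hk]; apply: eq_bigr => j /negbTE jt; case: ltnP => // jlt.
by rewrite (prefix_fun_upd t j) ?(ltnW jlt) // ffunE jt.
Qed.

(** Since [f] does not see coordinate [t], the kernel of round [t] sums to 1 and can be exchanged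
    for the uniform factor. *)
Lemma trunc_prob_step k (i : nat) (t : 'I_n) (f : {ffun 'I_n -> X} -> R) :
  causal k -> (i <= t)%N -> prefix_fun i f ->
  \sum_x trunc_prob k t.+1 x * f x = \sum_x trunc_prob k t x * f x.
Proof.
move=> hk it hf.
under eq_bigr do rewrite trunc_probD1.
rewrite (resample_kernel _ t (fun x =>
  \prod_(j < n | j != t) (if (j < t)%N then k j x (x j) else c))) //; last first.
  by move=> x y; exact: trunc_prob_upd.
apply: eq_bigr => x _; rewrite /trunc_prob [in RHS](bigD1 t) //= ltnn.
congr (_ * _); under eq_bigr do rewrite (prefix_fun_upd t i) //.
by rewrite -mulr_suml; case: hk => hk _; rewrite (proj2 (hk t x)) mul1r.
Qed.

Lemma sum_trunc_prob k (i : nat) (f : {ffun 'I_n -> X} -> R) :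
  causal k -> (i <= n)%N -> prefix_fun i f ->
  \sum_x (\prod_j k j x (x j)) * f x = \sum_x trunc_prob k i x * f x.
Proof.
move=> hk le_in hf.
transitivity (\sum_x trunc_prob k n x * f x).
  by apply: eq_bigr => x _; congr (_ * _); apply: eq_bigr => j _; rewrite ltn_ord.
have H d : (i + d <= n)%N ->
    \sum_x trunc_prob k (i + d) x * f x = \sum_x trunc_prob k i x * f x.
  elim: d => [|d IH]; first by rewrite addn0.
  rewrite addnS => hd; rewrite -IH ?(ltnW hd) //.
  exact: (trunc_prob_step _ i (Ordinal hd)) (leq_addr _ _) hf.
by rewrite -(H (n - i)%N) ?subnKC.
Qed.

Lemma causal_prob_dist k : (0 < #|X|)%N -> causal k ->
  is_dist (fun x => \prod_j k j x (x j)).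
Proof.
move=> X0 hk; split=> [x|].
  by apply: prodr_ge0 => j _; case: hk => h _; case: (h j x).
have := sum_trunc_prob k 0 (fun=> 1) hk (leq0n _) (fun _ _ _ => erefl).
under eq_bigr do rewrite mulr1; move=> ->.
under eq_bigr do rewrite mulr1.
rewrite /trunc_prob /= (sum_ffun_prod _ _ (fun=> fun=> c)) big1 // => i _.
by rewrite sumr_const -mulr_natl /c mulfV // pnatr_eq0 -lt0n.
Qed.

(** Truncation after round [i] makes it the last genuine round. Resampling coordinate [i] then
    exposes the conditional mean of [g] given the past, which is at least [v], under nonnegative
    weights. *)
Lemma causal_stage_ge k (i : 'I_n) (g : X -> R) (v : R) :
  (0 < #|X|)%N -> causal k -> (forall x, v <= \sum_y k i x y * g y) ->
  v <= \sum_x (\prod_j k j x (x j)) * g (x i).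
Proof.
move=> X0 hk hv.
have -> : v = \sum_x (\prod_j k j x (x j)) * v.
  by rewrite -mulr_suml (proj2 (causal_prob_dist k X0 hk)) mul1r.
rewrite -subr_ge0 -sumrB.
under eq_bigr do rewrite -mulrBr.
rewrite (sum_trunc_prob k i.+1 (fun x => g (x i) - v)) //; last first.
  by move=> x x' h; rewrite h.
under eq_bigr do rewrite trunc_probD1.
rewrite (resample_kernel _ i (fun x =>
  \prod_(j < n | j != i) (if (j < i)%N then k j x (x j) else c))) //; last first.
  by move=> x y; exact: trunc_prob_upd.
have c0 : 0 <= c by rewrite invr_ge0 ler0n.
apply: sumr_ge0 => x _; apply: mulr_ge0.
  apply: mulr_ge0 => //; apply: prodr_ge0 => j _; case: ifP => // _.
  by case: hk => h _; case: (h j x).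
under eq_bigr do rewrite ffunE eqxx mulrBr.
rewrite sumrB -mulr_suml; case: hk => h _.
by rewrite (proj2 (h i x)) mul1r subr_ge0.
Qed.

Lemma causal_eq_prefix k k' (t : nat) (f : {ffun 'I_n -> X} -> R) :
  causal k -> causal k' -> (forall (j : 'I_n) x, (j < t)%N -> k j x = k' j x) ->
  (t <= n)%N -> prefix_fun t f ->
  \sum_x (\prod_j k j x (x j)) * f x = \sum_x (\prod_j k' j x (x j)) * f x.
Proof.
move=> hk hk' e tn hf; rewrite !(sum_trunc_prob _ t) //.
apply: eq_bigr => x _; congr (_ * _); apply: eq_bigr => j _.
by case: ltnP => // jt; rewrite e.
Qed.

End CausalKernels.

(** * Existence of a good code *)

Section RandomCoding.
Context {R : realType}.

Lemma eventually_ge_nat (x : R) :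
  exists N : nat, forall n : nat, (N <= n)%N -> x <= n%:R.
Proof.
exists (Num.trunc x).+1 => n Nn; apply: (@le_trans _ _ (Num.trunc x).+1%:R).
  exact/ltW/truncnS_gt.
by rewrite ler_nat.
Qed.

Lemma sum_threshold (n k : nat) (a b : R) : (k <= n)%N ->
  \sum_(j < n) (if (j < k)%N then a else b) = k%:R * a + (n%:R - k%:R) * b.
Proof.
move=> kn; rewrite -(big_mkord predT (fun j => if (j < k)%N then a else b)).
rewrite (@big_cat_nat _ _ _ k) //=; congr (_ + _).
  rewrite (eq_big_nat _ _ (F2 := fun=> a)); last by move=> j /andP[_ ->].
  by rewrite sumr_const_nat subn0 mulr_natl.
rewrite (eq_big_nat _ _ (F2 := fun=> b)); last by move=> j /andP[kj _]; rewrite ltnNge kj.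
by rewrite sumr_const_nat -natrB // mulr_natl.
Qed.

Lemma powR2E (x : R) : 2 `^ x = expR (x * ln 2).
Proof. by rewrite /powR pnatr_eq0. Qed.

(** Twice the total variation distance between the output law of a uniformly chosen codeword and the
    i.i.d. law; the channel may change from round to round. *)
Definition output_tv {n K : nat} {U Y : finType} (W : 'I_n -> U -> Y -> R)
    (r : Y -> R) (c : {ffun 'I_K -> {ffun 'I_n -> U}}) : R :=
  \sum_(y : {ffun 'I_n -> Y})
    `|K%:R^-1 * (\sum_m \prod_j W j (c m j) (y j)) - \prod_j r (y j)|.

(** One codebook has to serve three purposes: cover the states through [W0], cover the outputs of
    the channel that switches at round [k], and have a good average of [V]. The three are combined
    into a single functional whose mean over random codebooks exceeds [P - eps], so some codebook
    attains that. *)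
Lemma exists_good_code (U Y0 Y : finType) (q : U -> R) (r0 : Y0 -> R) (r : Y -> R)
    (W0 : U -> Y0 -> R) (W : bool -> U -> Y -> R) (V : U -> R)
    (theta v1 v2 M Rt P eps : R) :
  is_dist q -> @channel_to R U Y0 q r0 W0 ->
  (forall b, @channel_to R U Y q r (W b)) ->
  v2 <= \sum_u q u * V u -> 0 <= theta <= 1 -> 0 <= M ->
  P <= theta * v1 + (1 - theta) * v2 ->
  kl_info q r0 W0 < Rt * ln 2 ->
  theta * kl_info q r (W true) + (1 - theta) * kl_info q r (W false) < Rt * ln 2 ->
  0 < eps ->
  exists N : nat, forall n : nat, (N <= n)%N -> (0 < n)%N /\
  exists (K k : nat) (c : {ffun 'I_K -> {ffun 'I_n -> U}}),
    [/\ (0 < K)%N, K%:R <= 2 `^ (n%:R * Rt), (k <= n)%N &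
     P - eps < n%:R^-1 * \sum_(i < n)
        (if (i < k)%N then v1 else K%:R^-1 * \sum_m V (c m i))
       - M * output_tv (fun=> W0) r0 c
       - M * output_tv (fun j : 'I_n => W (j < k)%N) r c].
Proof.
move=> hq hc0 hc hv2 /andP[th0 th1] M0 hP hI0 hI eps0.
set rt := Rt * ln 2 in hI0 hI *.
set I1 := kl_info q r (W true) in hI; set I2 := kl_info q r (W false) in hI.
have I10 : 0 <= I1 by exact: (kl_info_ge0 hq _ (hc true)).
have I20 : 0 <= I2 by exact: (kl_info_ge0 hq _ (hc false)).
have rt0 : 0 < rt by nra.
set Ith := theta * I1 + (1 - theta) * I2 in hI.
(* Each covering error, multiplied by [M], costs at most [eps / 6]; [M + 1] guards against
   [M = 0]. *)
pose e := eps / (6 * (M + 1)).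
have e0 : 0 < e by rewrite divr_gt0 // mulr_gt0 //; lra.
have Me : M * e <= eps / 6.
  have -> : eps / 6 = (M + 1) * e by rewrite /e; field; apply/eqP; lra.
  by rewrite ler_wpM2r ?ltW //; lra.
(* Aiming at the midpoint leaves room for the information lost in rounding [theta * n] down to
   [k]. *)
have hmid : (Ith + rt) / 2 < rt by lra.
have [Na hNa] := soft_covering _ _ _ _ (fun=> W0) _ _ _ hq (fun=> hc0) hI0 e0.
have [Nb hNb] := soft_covering _ _ _ _ W _ _ _ hq hc hmid e0.
(* Rounding [theta * n] costs at most [I2] nats and at most [|v1 - v2|] of total payoff; these two
   bounds on [n] make both losses negligible per round. *)
have [Nc hNc] := eventually_ge_nat (I2 / ((rt - Ith) / 2)).
have [Nd hNd] := eventually_ge_nat (`|v1 - v2| / (eps / 3)).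
exists (maxn 1 (maxn (maxn Na Nb) (maxn Nc Nd))) => n.
rewrite !geq_max => /andP[n0 /andP[/andP[na nb] /andP[nc nd]]]; split=> //.
have nR : 0 < n%:R :> R by rewrite ltr0n.
pose X : R := 2 `^ (n%:R * Rt).
have XE : X = expR (n%:R * rt) by rewrite /X powR2E /rt mulrA.
have X1 : 1 <= X by rewrite XE -expR0 ler_expR mulr_ge0 // ltW.
(* The largest codebook that the rate allows; as [X >= 1], the floor keeps at least half of [X]. *)
pose K := Num.trunc X.
have K0 : (0 < K)%N by rewrite truncn_gt0.
have KR : 1 <= K%:R :> R by rewrite ler1n.
have KX : K%:R <= X by rewrite truncn_le (le_trans ler01).
have XK : expR (n%:R * rt) <= 2 * K%:R.
  by rewrite -XE; have := truncnS_gt X; rewrite -/K -natr1; lra.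
pose k := Num.trunc (theta * n%:R).
have tn0 : 0 <= theta * n%:R by rewrite mulr_ge0 // ltW.
have kt : k%:R <= theta * n%:R by rewrite truncn_le.
have tk : theta * n%:R < k%:R + 1 by have := truncnS_gt (theta * n%:R); rewrite -/k -natr1.
have kn : (k <= n)%N by rewrite -(ler_nat R); nra.
have hS0 : \sum_(j < n) kl_info q r0 W0 <= n%:R * kl_info q r0 W0.
  by rewrite sumr_const card_ord mulr_natl.
have hS1 : \sum_(j < n) kl_info q r (W (j < k)%N) <= n%:R * ((Ith + rt) / 2).
  rewrite (eq_bigr (fun j : 'I_n => if (j < k)%N then I1 else I2)); last first.
    by move=> j _; case: ltnP.
  rewrite sum_threshold //.
  have := hNc n nc; rewrite ler_pdivrMr; last lra.
  have : (theta * n%:R - k%:R) * (I2 - I1) <= I2 by nra.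
  by rewrite /Ith; lra.
have A0 := hNa n na K (fun=> true) K0 XK hS0.
have A1 := hNb n nb K (fun j => (j < k)%N) K0 XK hS1.
pose pc (c : {ffun 'I_K -> {ffun 'I_n -> U}}) := \prod_m \prod_j q (c m j).
have dq : is_dist (fun v : {ffun 'I_n -> U} => \prod_j q (v j)).
  exact: (prod_dist _ _ (fun=> q)).
have [pc0 pc1] : is_dist pc.
  exact: (prod_dist _ _ (fun _ (v : {ffun 'I_n -> U}) => \prod_j q (v j))).
have mV (i : 'I_n) : \sum_c pc c * (K%:R^-1 * \sum_m V (c m i)) = \sum_u q u * V u.
  under eq_bigr do rewrite mulrCA mulr_sumr.
  rewrite -mulr_sumr exchange_big /=.
  under eq_bigr => m _.
    rewrite (sum_prod_marginal _ _ (fun _ (v : {ffun 'I_n -> U}) => \prod_j q (v j)) m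
       (fun v => V (v i))) //.
    rewrite (sum_prod_marginal _ _ (fun=> q) i V) //.
    over.
  by rewrite sumr_const card_ord -[X in _ * X]mulr_natl mulKf // gt_eqF // ltr0n.
suff : P - eps < \sum_c pc c * (n%:R^-1 * \sum_(i < n)
        (if (i < k)%N then v1 else K%:R^-1 * \sum_m V (c m i))
       - M * output_tv (fun=> W0) r0 c
       - M * output_tv (fun j : 'I_n => W (j < k)%N) r c).
  by move=> /(exists_gt_of_mean _ _ _ _ (conj pc0 pc1)) [c hcc]; exists K, k, c; split.
under eq_bigr do rewrite !mulrBr ![pc _ * (M * _)]mulrCA.
rewrite !sumrB -!mulr_sumr.
have -> : \sum_c pc c * (n%:R^-1 * \sum_(i < n)
        (if (i < k)%N then v1 else K%:R^-1 * \sum_m V (c m i))) =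
   n%:R^-1 * (k%:R * v1 + (n%:R - k%:R) * \sum_u q u * V u).
  under eq_bigr do rewrite mulrCA mulr_sumr.
  rewrite -mulr_sumr exchange_big /= -sum_threshold //; congr (_ * _).
  apply: eq_bigr => i _; case: ifP => _; last exact: mV.
  by rewrite -mulr_suml pc1 mul1r.
have B0 : M * \sum_c pc c * output_tv (fun=> W0) r0 c <= eps / 6.
  by apply: le_trans Me; rewrite ler_wpM2l.
have B1 : M * \sum_c pc c * output_tv (fun j : 'I_n => W (j < k)%N) r c <= eps / 6.
  by apply: le_trans Me; rewrite ler_wpM2l.
suff : P - eps / 3 <= n%:R^-1 * (k%:R * v1 + (n%:R - k%:R) * \sum_u q u * V u).
  by move: B0 B1; lra.
have knR : k%:R <= n%:R :> R by rewrite ler_nat.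
apply: (@le_trans _ _ (n%:R^-1 * (k%:R * v1 + (n%:R - k%:R) * v2))); last first.
  by rewrite ler_wpM2l ?invr_ge0 ?(ltW nR) // lerD2l ler_wpM2l // subr_ge0.
rewrite -(@ler_pM2l _ n%:R) // mulVKf ?gt_eqF //.
have := hNd n nd; rewrite ler_pdivrMr; last lra.
have : (theta * n%:R - k%:R) * (v1 - v2) <= `|v1 - v2|.
  apply: (le_trans (ler_norm _)); rewrite normrM ger0_norm ?subr_ge0 //.
  by rewrite ler_piMl //; lra.
have : n%:R * P <= n%:R * (theta * v1 + (1 - theta) * v2) by rewrite ler_wpM2l // ltW.
lra.
Qed.

End RandomCoding.

(** * The protocol against a fixed strategy of Player B *)

Section PairFunctions.
Context {R : realType} {I X1 X2 : finType}.

Definition fstf (z : {ffun I -> X1 * X2}) : {ffun I -> X1} := [ffun j => (z j).1].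
Definition sndf (z : {ffun I -> X1 * X2}) : {ffun I -> X2} := [ffun j => (z j).2].

(** Turns two jointly drawn sequences into one over the product alphabet, the form in which causal
    kernels apply. *)
Lemma sum_ffun_pair (F : {ffun I -> X1} -> {ffun I -> X2} -> R) :
  \sum_x \sum_y F x y = \sum_(z : {ffun I -> X1 * X2}) F (fstf z) (sndf z).
Proof.
rewrite pair_bigA /=.
rewrite (reindex (fun z : {ffun I -> X1 * X2} => (fstf z, sndf z))) //=.
exists (fun xy : {ffun I -> X1} * {ffun I -> X2} => [ffun j => (xy.1 j, xy.2 j)]) => [z _|[x y] _] /=.
  by apply/ffunP => j; rewrite !ffunE -surjective_pairing.
by congr pair; apply/ffunP => j; rewrite !ffunE.
Qed.

End PairFunctions.

Section FiniteMeans.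
Context {R : realType}.

Lemma dist_mean_norm_le (T : finType) (p f : T -> R) (M : R) :
  is_dist p -> (forall t, `|f t| <= M) -> `|\sum_t p t * f t| <= M.
Proof.
move=> [p0 p1] hf; apply: (le_trans (ler_norm_sum _ _ _)).
rewrite -[leRHS]mul1r -p1 mulr_suml; apply: ler_sum => t _.
by rewrite normrM ger0_norm // ler_wpM2l.
Qed.

Lemma mean_ge_tv (T : finType) (p p' f : T -> R) (M : R) :
  (forall t, `|f t| <= M) ->
  \sum_t p' t * f t - M * \sum_t `|p t - p' t| <= \sum_t p t * f t.
Proof.
move=> hf; rewrite lerBlDr -lerBlDl -sumrB mulr_sumr.
apply: ler_sum => t _; rewrite -mulrBl.
apply: (le_trans (ler_norm _)); rewrite normrM mulrC distrC.
by rewrite ler_wpM2r.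
Qed.

End FiniteMeans.

Section Protocol.
Context {R : realType} {S A B U : finType} {n K : nat}.
Variables (pS : S -> R) (Pi : A -> B -> S -> R).
Variables (pSU : U -> S -> R) (pAU : U -> A -> R).
Variable c : {ffun 'I_K -> {ffun 'I_n -> U}}.
Hypothesis hpS : is_dist pS.
Hypothesis hpSU : forall u, is_dist (pSU u).
Hypothesis hpAU : forall u, is_dist (pAU u).
Hypothesis K0 : (0 < K)%N.
Hypothesis n0 : (0 < n)%N.

Definition likelihood (s : {ffun 'I_n -> S}) (m : 'I_K) : R :=
  \prod_j pSU (c m j) (s j).

(** The posterior of a uniform message given that [s] came out of the channel [pSU]; if no codeword
    can produce [s], the message is uniform by default. *)
Definition likelihood_encoder (s : {ffun 'I_n -> S}) (m : 'I_K) : R :=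
  if \sum_m' likelihood s m' == 0 then K%:R^-1
  else likelihood s m / \sum_m' likelihood s m'.

Definition code_strategy (i : 'I_n) (m : 'I_K) (h : hist S A B n) : A -> R :=
  pAU (c m i).

Let KR : 0 < K%:R :> R. Proof. by rewrite ltr0n. Qed.
Let nR : 0 < n%:R :> R. Proof. by rewrite ltr0n. Qed.

Lemma likelihood_ge0 s m : 0 <= likelihood s m.
Proof. by apply: prodr_ge0 => j _; case: (hpSU (c m j)). Qed.

Lemma sum_cst_invK : \sum_(m < K) K%:R^-1 = 1 :> R.
Proof. by rewrite sumr_const card_ord -[LHS]mulr_natl mulfV // gt_eqF. Qed.

Lemma likelihood_encoder_dist s : is_dist (likelihood_encoder s).
Proof.
rewrite /likelihood_encoder; split=> [m|].
  case: eqP => _; first by rewrite invr_ge0 ltW.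
  by rewrite divr_ge0 ?likelihood_ge0 //; apply: sumr_ge0 => *; exact: likelihood_ge0.
case: eqP => [_|/eqP nz]; first exact: sum_cst_invK.
by rewrite -mulr_suml mulfV.
Qed.

(** The true and the ideal joint law share the conditional law of the message given [s], so their
    distance reduces to that of the state marginals. Where all likelihoods vanish, only the true
    mass of [s] remains on both sides. *)
Lemma likelihood_encoder_tv :
  \sum_(s : {ffun 'I_n -> S}) \sum_m `|(\prod_j pS (s j)) * likelihood_encoder s m
                  - K%:R^-1 * likelihood s m| <=
  output_tv (fun=> pSU) pS c.
Proof.
apply: ler_sum => s _; rewrite -/(likelihood s _).
set p := \prod_j pS (s j).
have p0 : 0 <= p by apply: prodr_ge0 => j _; case: hpS.
set Ls := \sum_m likelihood s m.
have [z|nz] := eqVneq Ls 0.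
  have l0 m : likelihood s m = 0.
    by apply: (psumr_eq0P (P := predT)) => // m' _; exact: likelihood_ge0.
  have E m : `|p * likelihood_encoder s m - K%:R^-1 * likelihood s m| = p * K%:R^-1.
    rewrite /likelihood_encoder -/Ls z eqxx l0 mulr0 subr0 ger0_norm //.
    by rewrite mulr_ge0 // invr_ge0 ltW.
  under eq_bigr do rewrite E.
  rewrite -mulr_sumr sum_cst_invK mulr1.
  by rewrite z mulr0 sub0r normrN ler_norm.
have Lp : 0 < Ls by rewrite lt0r nz; apply: sumr_ge0 => m _; exact: likelihood_ge0.
have E m : `|p * likelihood_encoder s m - K%:R^-1 * likelihood s m| =
    (likelihood s m / Ls) * `|K%:R^-1 * Ls - p|.
  rewrite -[X in X * `|_|]ger0_norm; last first.
    by rewrite divr_ge0 ?likelihood_ge0 // ltW.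
  rewrite -normrM distrC /likelihood_encoder -/Ls (negbTE nz); congr `|_|.
  by field; rewrite nz gt_eqF.
under eq_bigr do rewrite E.
by rewrite -!mulr_suml mulfV // mul1r.
Qed.

Section AgainstB.
Variable sB : 'I_n -> {ffun 'I_n -> S} -> hist S A B n -> B -> R.
Hypothesis hsB : forall i s h, is_dist (sB i s h).
Variable M : R.
Hypothesis hM : forall a b s, `|Pi a b s| <= M.

Definition stage_payoff (i : 'I_n) (s : {ffun 'I_n -> S}) (a : {ffun 'I_n -> A}) : R :=
  \sum_(b : {ffun 'I_n -> B})
    (\prod_j sB j s (hist_of a b s j) (b j)) * Pi (a i) (b i) (s i).

Lemma hist_of_prefix (a a' : {ffun 'I_n -> A}) (b b' : {ffun 'I_n -> B})
    (s s' : {ffun 'I_n -> S}) (j : 'I_n) :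
  (forall l : 'I_n, (l < j)%N -> [/\ a l = a' l, b l = b' l & s l = s' l]) ->
  hist_of a b s j = hist_of a' b' s' j.
Proof.
by move=> h; apply/ffunP => l; rewrite !ffunE; case: ltnP => // /h [-> -> ->].
Qed.

Lemma B_causal s a : causal (fun j (b : {ffun 'I_n -> B}) => sB j s (hist_of a b s j)).
Proof.
split=> [j b|j b b' h]; first exact: hsB.
by congr (sB j s); apply: hist_of_prefix => l lj; split=> //; exact: h.
Qed.

Lemma cardB_gt0 : (0 < #|B|)%N.
Proof.
have [s] := dist_inhabited _ _ _ hpS.
have [b] := dist_inhabited _ _ _ (hsB (Ordinal n0) [ffun=> s] [ffun=> None]).
by apply/card_gt0P; exists b.
Qed.

Lemma stage_payoff_le i s a : `|stage_payoff i s a| <= M.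
Proof.
apply: (dist_mean_norm_le _ (fun b : {ffun 'I_n -> B} =>
  \prod_j sB j s (hist_of a b s j) (b j))) => //.
exact: (causal_prob_dist _ cardB_gt0 (B_causal s a)).
Qed.

(** The state-action weights [w] are a parameter so that real play can be compared with surrogate
    laws against the same [sB]. *)
Definition stage_mean (i : 'I_n) (w : 'I_n -> S -> A -> R) : R :=
  \sum_(s : {ffun 'I_n -> S}) \sum_(a : {ffun 'I_n -> A})
    (\prod_j w j (s j) (a j)) * stage_payoff i s a.

Definition true_channel (u : U) (s : S) (a : A) : R := pSU u s * pAU u a.

(** By [likelihood_encoder_tv], passing to a uniform message with states drawn from its codeword
    costs at most [M] times the covering distance, because the conditional payoff [G] is bounded by
    [M]. *)
Lemma payoff_ge_stages :
  n%:R^-1 * \sum_i K%:R^-1 * \sum_m stage_mean i (fun j => true_channel (c m j))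
    - M * output_tv (fun=> pSU) pS c <=
  exp_avg_payoff pS Pi likelihood_encoder code_strategy sB.
Proof.
pose G s m := \sum_(a : {ffun 'I_n -> A}) (\prod_j pAU (c m j) (a j)) *
   (n%:R^-1 * \sum_i stage_payoff i s a).
have -> : exp_avg_payoff pS Pi likelihood_encoder code_strategy sB =
   \sum_(s : {ffun 'I_n -> S}) \sum_m
     (\prod_j pS (s j)) * likelihood_encoder s m * G s m.
  apply: eq_bigr => s _; apply: eq_bigr => m _.
  rewrite /G mulr_sumr; apply: eq_bigr => a _.
  transitivity (\sum_(b : {ffun 'I_n -> B}) \sum_i
     (\prod_j pS (s j)) * likelihood_encoder s m *
     ((\prod_j pAU (c m j) (a j)) * (n%:R^-1 *
      ((\prod_j sB j s (hist_of a b s j) (b j)) * Pi (a i) (b i) (s i))))).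
    apply: eq_bigr => b _; rewrite big_split /= -!mulr_sumr /code_strategy; ring.
  rewrite exchange_big /= !mulr_sumr; apply: eq_bigr => i _.
  by rewrite /stage_payoff !mulr_sumr.
have GM s m : `|G s m| <= M.
  apply: (dist_mean_norm_le _ (fun a : {ffun 'I_n -> A} => \prod_j pAU (c m j) (a j))).
    exact: (prod_dist _ _ (fun j => pAU (c m j))).
  move=> a; rewrite normrM ger0_norm ?invr_ge0 ?(ltW nR) //.
  rewrite -(@ler_pM2l _ n%:R) // mulVKf ?gt_eqF //.
  apply: (le_trans (ler_norm_sum _ _ _)).
  rewrite mulr_natl -[X in _ *+ X]card_ord -sumr_const; apply: ler_sum => i _.
  exact: stage_payoff_le.
have M0 : 0 <= M.
  have [s] := dist_inhabited _ _ _ hpS.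
  exact: le_trans (normr_ge0 _) (GM [ffun=> s] (Ordinal K0)).
rewrite [leRHS]pair_bigA /=.
apply: le_trans (mean_ge_tv _ _ (fun z : {ffun 'I_n -> S} * 'I_K =>
    K%:R^-1 * likelihood z.1 z.2) _ M _); last by move=> z; exact: GM.
rewrite -(pair_bigA _ (fun s m => K%:R^-1 * likelihood s m * G s m)) /=.
rewrite -(pair_bigA _ (fun (s : {ffun 'I_n -> S}) m => `|(\prod_j pS (s j)) * likelihood_encoder s m
                  - K%:R^-1 * likelihood s m|)) /=.
apply: lerB; last by rewrite ler_wpM2l // likelihood_encoder_tv.
rewrite le_eqVlt; apply/orP; left; apply/eqP.
rewrite [RHS]exchange_big /= -mulr_sumr mulrCA exchange_big /=.
under [RHS]eq_bigr do under eq_bigr do rewrite -mulrA.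
under [RHS]eq_bigr do rewrite -mulr_sumr.
rewrite -mulr_sumr; congr (_ * _).
rewrite mulr_sumr; apply: eq_bigr => m _.
rewrite /stage_mean exchange_big /= mulr_sumr; apply: eq_bigr => s _.
rewrite exchange_big /= /G !mulr_sumr; apply: eq_bigr => a _.
rewrite -mulr_sumr /true_channel big_split /= /likelihood; ring.
Qed.

Variables (W : bool -> U -> S * A -> R) (r : S * A -> R) (k : nat).

(* As long as the codebook covers the channel output, Player B cannot tell the
   first [k] rounds from rounds driven by i.i.d. pairs of law [r]. *)
Lemma payoff_ge_covering (V : U -> R) (v1 : R) :
  (forall (i : 'I_n) (u : 'I_n -> U), (i < k)%N ->
    stage_mean i (fun j => true_channel (u j)) =
    stage_mean i (fun j s a => W (j < k)%N (u j) (s, a))) ->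
  (forall i : 'I_n, v1 <= stage_mean i (fun _ s a => r (s, a))) ->
  (forall (i : 'I_n) (u : 'I_n -> U),
     V (u i) <= stage_mean i (fun j => true_channel (u j))) ->
  n%:R^-1 * \sum_(i < n)
        (if (i < k)%N then v1 else K%:R^-1 * \sum_m V (c m i))
       - M * output_tv (fun=> pSU) pS c
       - M * output_tv (fun j : 'I_n => W (j < k)%N) r c <=
  exp_avg_payoff pS Pi likelihood_encoder code_strategy sB.
Proof.
move=> hk hr hV; apply: le_trans payoff_ge_stages.
set TV1 := output_tv _ r c; set TV0 := output_tv _ _ _.
rewrite addrAC lerD2r.
have TV10 : 0 <= M * TV1.
  rewrite mulr_ge0 ?sumr_ge0 //.
  have [s] := dist_inhabited _ _ _ hpS.
  have /card_gt0P[b _] := cardB_gt0.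
  have [a] := dist_inhabited _ _ _ (hpAU (c (Ordinal K0) (Ordinal n0))).
  exact: le_trans (normr_ge0 _) (hM a b s).
(* The penalty is spread evenly over the rounds; from round [k] on it is dropped as nonnegative. *)
have -> : M * TV1 = n%:R^-1 * \sum_(i < n) M * TV1.
  by rewrite sumr_const card_ord -[X in _ = _ * X]mulr_natl mulKf // gt_eqF.
rewrite -mulrBr -sumrB ler_wpM2l ?invr_ge0 ?(ltW nR) //.
apply: ler_sum => i _; case: ltnP => ik; last first.
  rewrite lerBlDr; apply: ler_wpDr => //.
  rewrite ler_wpM2l ?invr_ge0 ?(ltW KR) //; apply: ler_sum => m _; exact: hV.
(* Rounds before [k] are unaffected by what follows them, so the switching channel may replace the
   true one throughout the block; its output law is the covered one. *)
rewrite (eq_bigr _ (fun m _ => hk i (fun j => c m j) ik)).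
rewrite lerBlDr (le_trans (hr i)) // -lerBlDr.
pose f (y : {ffun 'I_n -> S * A}) := stage_payoff i (fstf y) (sndf y).
have -> : stage_mean i (fun _ s a => r (s, a)) =
    \sum_(y : {ffun 'I_n -> S * A}) (\prod_j r (y j)) * f y.
  rewrite /stage_mean sum_ffun_pair; apply: eq_bigr => y _; congr (_ * _).
  by apply: eq_bigr => j _; rewrite !ffunE -surjective_pairing.
have -> : K%:R^-1 * \sum_m stage_mean i (fun j s a => W (j < k)%N (c m j) (s, a)) =
    \sum_(y : {ffun 'I_n -> S * A})
      (K%:R^-1 * \sum_m \prod_(j < n) W (j < k)%N (c m j) (y j)) * f y.
  under [RHS]eq_bigr do rewrite -mulrA mulr_suml.
  rewrite -mulr_sumr [X in _ = _ * X]exchange_big /=; congr (_ * _); apply: eq_bigr => m _.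
  rewrite /stage_mean sum_ffun_pair; apply: eq_bigr => y _; congr (_ * _).
  by apply: eq_bigr => j _; rewrite !ffunE -surjective_pairing.
by apply: mean_ge_tv => y; exact: stage_payoff_le.
Qed.

End AgainstB.
End Protocol.

(** * Payoff of a single round *)

Lemma dist_le1 (R : realType) (T : finType) (p : T -> R) t : is_dist p -> p t <= 1.
Proof. by move=> [p0 <-]; rewrite (bigD1 t) //= lerDl sumr_ge0. Qed.

Lemma prod_dist2 (R : realType) (X Y : finType) (p : X -> R) (p' : X -> Y -> R) :
  is_dist p -> (forall x, is_dist (p' x)) ->
  is_dist (fun z : X * Y => p z.1 * p' z.1 z.2).
Proof.
move=> [p0 p1] h; split=> [z|].
  by rewrite mulr_ge0 //; case: (h z.1).
rewrite -(pair_bigA _ (fun x y => p x * p' x y)) /= -[RHS]p1.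
by apply: eq_bigr => x _; rewrite -mulr_sumr (proj2 (h x)) mulr1.
Qed.

Section MixedKernel.
Context {R : realType} {n : nat} {X Y : finType}.
Variable be : 'I_n -> {ffun 'I_n -> X * Y} -> Y -> R.
Hypothesis hbe : forall j x, is_dist (be j x).
Hypothesis hpre : forall j : 'I_n, prefix_fun j (be j).

Definition mixed_kernel (al : 'I_n -> X -> R) (j : 'I_n) (x : {ffun 'I_n -> X * Y})
    (y : X * Y) : R := al j y.1 * be j x y.2.

Lemma mixed_kernel_causal al : (forall j, is_dist (al j)) -> causal (mixed_kernel al).
Proof.
move=> hal; split=> [j x|j x x' h].
  exact: (prod_dist2 _ _ _ (al j) (fun=> be j x)).
by apply/funext => y; rewrite /mixed_kernel (hpre j _ _ h).
Qed.

(** Given the past, letter and reply are independent; a bound against every pure reply passes to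
    their mixture. *)
Lemma mixed_stage_ge al (i : 'I_n) (g : X -> Y -> R) (v : R) :
  (0 < #|{: X * Y}|)%N -> (forall j, is_dist (al j)) ->
  (forall y, v <= \sum_x al i x * g x y) ->
  v <= \sum_(z : {ffun 'I_n -> X * Y})
    (\prod_j mixed_kernel al j z (z j)) * g (z i).1 (z i).2.
Proof.
move=> X0 hal hv.
apply: (causal_stage_ge _ i (fun y => g y.1 y.2)) => //.
  exact: mixed_kernel_causal.
move=> z; rewrite -(pair_bigA _ (fun x y => al i x * be i z y * g x y)) /=.
rewrite exchange_big /=; have [b0 b1] := hbe i z.
rewrite -[leLHS]mul1r -b1 mulr_suml; apply: ler_sum => y _.
under eq_bigr do rewrite mulrAC [al _ _ * _ * _]mulrC.
by rewrite -mulr_sumr ler_wpM2l.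
Qed.

Lemma mixed_eq_prefix al al' (i : 'I_n) (k : nat) (g : X -> Y -> R) :
  (forall j, is_dist (al j)) -> (forall j, is_dist (al' j)) ->
  (forall j : 'I_n, (j < k)%N -> al j = al' j) -> (i < k)%N -> (k <= n)%N ->
  \sum_(z : {ffun 'I_n -> X * Y})
    (\prod_j mixed_kernel al j z (z j)) * g (z i).1 (z i).2 =
  \sum_(z : {ffun 'I_n -> X * Y})
    (\prod_j mixed_kernel al' j z (z j)) * g (z i).1 (z i).2.
Proof.
move=> h h' e ik kn; apply: (causal_eq_prefix _ _ k) => //.
- exact: mixed_kernel_causal.
- exact: mixed_kernel_causal.
- by move=> j x jk; apply/funext => y; rewrite /mixed_kernel e.
- by move=> x x' hx; rewrite hx.
Qed.

End MixedKernel.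

Section StageBounds.
Context {R : realType} {S A B : finType} {n : nat}.
Variable Pi : A -> B -> S -> R.
Variable sB : 'I_n -> {ffun 'I_n -> S} -> hist S A B n -> B -> R.
Hypothesis hsB : forall i s h, is_dist (sB i s h).
Hypothesis B0 : (0 < #|B|)%N.

Section Uninformed.
Hypothesis hunif : forall i s s' h, sB i s h = sB i s' h.

Let be (j : 'I_n) (z : {ffun 'I_n -> (S * A) * B}) : B -> R :=
  sB j (fstf (fstf z)) (hist_of (sndf (fstf z)) (sndf z) (fstf (fstf z)) j).

Lemma response_dist j z : is_dist (be j z). Proof. exact: hsB. Qed.

(** [sB] formally receives the whole state sequence; [hunif] lets that argument be replaced, so only
    the past recorded in the history matters. *)
Lemma response_prefix (j : 'I_n) : prefix_fun j (be j).
Proof.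
move=> z z' h; rewrite /be (hunif _ _ (fstf (fstf z'))); congr (sB j _).
by apply: hist_of_prefix => l lj; rewrite !ffunE h.
Qed.

(** Each round draws the state together with the action and the reply; by [response_prefix] this is
    a causal kernel on triples. *)
Lemma stage_meanE_uninformed i (w : 'I_n -> S -> A -> R) :
  stage_mean Pi sB i w = \sum_(z : {ffun 'I_n -> (S * A) * B})
    (\prod_j mixed_kernel be (fun j y => w j y.1 y.2) j z (z j)) *
    Pi (z i).1.2 (z i).2 (z i).1.1.
Proof.
rewrite /stage_mean sum_ffun_pair /stage_payoff.
under eq_bigr do rewrite mulr_sumr.
rewrite sum_ffun_pair; apply: eq_bigr => z _; rewrite mulrA -big_split /=.
by rewrite !ffunE; congr (_ * _); apply: eq_bigr => j _; rewrite !ffunE.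
Qed.

Lemma stage_mean_ge_uninformed i (w : 'I_n -> S -> A -> R) (v : R) :
  (forall j, is_dist (fun y : S * A => w j y.1 y.2)) ->
  (forall b, v <= \sum_s \sum_a w i s a * Pi a b s) ->
  v <= stage_mean Pi sB i w.
Proof.
move=> hw hv; rewrite stage_meanE_uninformed.
apply: (mixed_stage_ge _ response_dist response_prefix (fun j y => w j y.1 y.2) i
  (fun (y : S * A) b => Pi y.2 b y.1)) => //.
  have [y] := dist_inhabited _ _ _ (hw i).
  by have /card_gt0P[b _] := B0; apply/card_gt0P; exists (y, b).
by move=> b; rewrite -(pair_bigA _ (fun s a => w i s a * Pi a b s)).
Qed.

Lemma stage_mean_prefix_uninformed (i : 'I_n) (k : nat) (w w' : 'I_n -> S -> A -> R) :
  (forall j, is_dist (fun y : S * A => w j y.1 y.2)) ->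
  (forall j, is_dist (fun y : S * A => w' j y.1 y.2)) ->
  (forall j : 'I_n, (j < k)%N -> w j = w' j) -> (i < k)%N -> (k <= n)%N ->
  stage_mean Pi sB i w = stage_mean Pi sB i w'.
Proof.
move=> hw hw' e ik kn; rewrite !stage_meanE_uninformed.
apply: (mixed_eq_prefix _ response_dist response_prefix _ _ i k
  (fun (y : S * A) b => Pi y.2 b y.1)) => // j jk.
by rewrite e.
Qed.

End Uninformed.

Section Informed.

Let be (s : {ffun 'I_n -> S}) (j : 'I_n) (z : {ffun 'I_n -> A * B}) : B -> R :=
  sB j s (hist_of (fstf z) (sndf z) s j).

Lemma informed_response_dist s j z : is_dist (be s j z). Proof. exact: hsB. Qed.

Lemma informed_response_prefix s (j : 'I_n) : prefix_fun j (be s j).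
Proof.
move=> z z' h; rewrite /be; congr (sB j _).
by apply: hist_of_prefix => l lj; rewrite !ffunE h.
Qed.

(** Replies may depend on future states, so the state sequence is fixed first and only actions and
    replies form a causal kernel. Hence the weights must split into a state part [om] and an action
    part [al]. *)
Lemma stage_meanE_informed i (om : 'I_n -> S -> R) (al : 'I_n -> S -> A -> R) :
  stage_mean Pi sB i (fun j s a => om j s * al j s a) =
  \sum_(s : {ffun 'I_n -> S}) (\prod_j om j (s j)) *
    \sum_(z : {ffun 'I_n -> A * B})
    (\prod_j mixed_kernel (be s) (fun j => al j (s j)) j z (z j)) *
    Pi (z i).1 (z i).2 (s i).
Proof.
rewrite /stage_mean; apply: eq_bigr => s _ /=.
under eq_bigr do rewrite big_split /= -mulrA.
rewrite -mulr_sumr; congr (_ * _).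
rewrite /stage_payoff; under [LHS]eq_bigr do rewrite mulr_sumr.
rewrite sum_ffun_pair; apply: eq_bigr => z _; rewrite mulrA -big_split /=.
by rewrite !ffunE; congr (_ * _); apply: eq_bigr => j _; rewrite !ffunE.
Qed.

Lemma stage_mean_ge_informed i (om : 'I_n -> S -> R) (al : 'I_n -> S -> A -> R)
    (v : S -> R) :
  (forall j, is_dist (om j)) -> (forall j s, is_dist (al j s)) ->
  (forall s b, v s <= \sum_a al i s a * Pi a b s) ->
  \sum_s om i s * v s <= stage_mean Pi sB i (fun j s a => om j s * al j s a).
Proof.
move=> hom hal hv; rewrite stage_meanE_informed.
rewrite -(sum_prod_marginal _ _ om i v) //; apply: ler_sum => s _.
rewrite ler_wpM2l ?prodr_ge0 // => [j _|]; first by case: (hom j).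
apply: (mixed_stage_ge _ (informed_response_dist s) (informed_response_prefix s)
  (fun j => al j (s j)) i (fun a b => Pi a b (s i))) => //.
have [a] := dist_inhabited _ _ _ (hal i (s i)).
by have /card_gt0P[b _] := B0; apply/card_gt0P; exists (a, b).
Qed.

(** Both sides share [om]: Player B sees all states, so only the action part of late rounds can be
    exchanged. This is why [I(U;S)] is charged for the whole block in case (ii). *)
Lemma stage_mean_prefix_informed (i : 'I_n) (k : nat) (om : 'I_n -> S -> R)
    (al al' : 'I_n -> S -> A -> R) :
  (forall j s, is_dist (al j s)) -> (forall j s, is_dist (al' j s)) ->
  (forall j : 'I_n, (j < k)%N -> al j = al' j) -> (i < k)%N -> (k <= n)%N ->
  stage_mean Pi sB i (fun j s a => om j s * al j s a) =
  stage_mean Pi sB i (fun j s a => om j s * al' j s a).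
Proof.
move=> h h' e ik kn; rewrite !stage_meanE_informed.
apply: eq_bigr => s _; congr (_ * _).
apply: (mixed_eq_prefix _ (informed_response_dist s) (informed_response_prefix s) _ _ i k
  (fun a b => Pi a b (s i))) => // j jk.
by rewrite e.
Qed.

End Informed.
End StageBounds.

(** * Channels induced by the auxiliary variable *)

Section Information.
Context {R : realType}.

Lemma ln2_gt0 : 0 < ln 2 :> R.
Proof. by rewrite ln_gt0 // ltr1n. Qed.

Lemma mutinf_channel (U Y : finType) (q : U -> R) (r : Y -> R) (W : U -> Y -> R) :
  is_dist q -> @channel_to R U Y q r W ->
  mutinf (fun u y => q u * W u y) * ln 2 = kl_info q r W.
Proof.
move=> hq hc; have [hW hr] := (hc).
rewrite /mutinf mulr_suml; apply: eq_bigr => u _.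
rewrite mulr_suml; apply: eq_bigr => y _.
rewrite /log2 -mulrA divfK ?gt_eqF ?ln2_gt0 //.
have [z|nz] := eqVneq (q u * W u y) 0; first by rewrite z !mul0r.
rewrite -mulr_sumr (proj2 (hW u)) mulr1 -hr; congr (_ * ln _).
have qz : q u != 0 by apply: contra_neq nz => ->; rewrite mul0r.
by rewrite -mulf_div divff // mul1r.
Qed.

End Information.

Section Achievability.
Context {R : realType} {S A B U : finType}.
Variables (pS : S -> R) (Pi : A -> B -> S -> R).
Variables (pUS : S -> U -> R) (pAU : U -> A -> R).
Hypothesis hpS : is_dist pS.
Hypothesis hpUS : forall s, is_dist (pUS s).
Hypothesis hpAU : forall u, is_dist (pAU u).

Definition pU (u : U) : R := \sum_s pS s * pUS s u.

(* Where [pU u = 0] the conditional law is arbitrary; [pS] keeps it a distribution. *)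
Definition pS_U (u : U) (s : S) : R :=
  if pU u == 0 then pS s else pS s * pUS s u / pU u.

Let pAS := pA_S pUS pAU.

Lemma pS_ge0 s : 0 <= pS s. Proof. by case: hpS. Qed.
Lemma pUS_ge0 s u : 0 <= pUS s u. Proof. by case: (hpUS s). Qed.
Lemma pAU_ge0 u a : 0 <= pAU u a. Proof. by case: (hpAU u). Qed.

Lemma pU_dist : is_dist pU.
Proof.
split=> [u|]; first by apply: sumr_ge0 => s _; rewrite mulr_ge0 ?pS_ge0 ?pUS_ge0.
rewrite exchange_big /= -[RHS](proj2 hpS); apply: eq_bigr => s _.
by rewrite -mulr_sumr (proj2 (hpUS s)) mulr1.
Qed.

Lemma pU_pS_U u s : pU u * pS_U u s = pS s * pUS s u.
Proof.
rewrite /pS_U; case: eqP => [z|/eqP nz]; last by rewrite mulrC divfK.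
rewrite z mul0r; apply/esym/(psumr_eq0P (P := predT) _ z) => // s' _.
by rewrite mulr_ge0 ?pS_ge0 ?pUS_ge0.
Qed.

Lemma pS_U_dist u : is_dist (pS_U u).
Proof.
rewrite /pS_U; case: eqP => [//|/eqP nz]; split=> [s|].
  by rewrite divr_ge0 ?mulr_ge0 ?pS_ge0 ?pUS_ge0 //; case: pU_dist.
by rewrite -mulr_suml mulfV.
Qed.

Lemma pAS_dist s : is_dist (pAS s).
Proof.
split=> [a|]; first by apply: sumr_ge0 => u _; rewrite mulr_ge0 ?pUS_ge0 ?pAU_ge0.
rewrite exchange_big /= -[RHS](proj2 (hpUS s)); apply: eq_bigr => u _.
by rewrite -mulr_sumr (proj2 (hpAU u)) mulr1.
Qed.

Definition pSA (y : S * A) : R := pS y.1 * pAS y.1 y.2.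

Lemma pS_U_channel : @channel_to R U S pU pS pS_U.
Proof.
split=> [|s]; first exact: pS_U_dist.
by under eq_bigr do rewrite pU_pS_U; rewrite -mulr_sumr (proj2 (hpUS s)) mulr1.
Qed.

Definition action_channel (u : U) (y : S * A) : R := pS_U u y.1 * pAU u y.2.
(* Substitutes for [action_channel] in the rounds after the covering phase: they
   have the same output law [pSA], but reveal only what Player B may later see
   (the states if informed, nothing otherwise). *)
Definition state_channel (u : U) (y : S * A) : R := pS_U u y.1 * pAS y.1 y.2.
Definition null_channel (u : U) (y : S * A) : R := pSA y.

Lemma action_channel_to : @channel_to R U (S * A)%type pU pSA action_channel.
Proof.
split=> [u|y].
  exact: (prod_dist2 _ _ _ (pS_U u) (fun=> pAU u) (pS_U_dist u)).
rewrite /pSA /pAS /pA_S mulr_sumr; apply: eq_bigr => u _.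
by rewrite mulrA mulrA pU_pS_U.
Qed.

Lemma state_channel_to : @channel_to R U (S * A)%type pU pSA state_channel.
Proof.
split=> [u|y].
  exact: (prod_dist2 _ _ _ (pS_U u) pAS (pS_U_dist u) pAS_dist).
have [_ h] := pS_U_channel; rewrite /pSA h mulr_suml.
by apply: eq_bigr => u _; rewrite mulrA.
Qed.

Lemma null_channel_to : @channel_to R U (S * A)%type pU pSA null_channel.
Proof.
split=> [u|y]; first exact: (prod_dist2 _ _ _ pS pAS hpS pAS_dist).
by rewrite -mulr_suml (proj2 pU_dist) mul1r.
Qed.

Lemma mutinf_state : mutinf (fun u s => pS s * pUS s u) * ln 2 = kl_info pU pS pS_U.
Proof.
rewrite -(mutinf_channel _ _ _ _ _ pU_dist pS_U_channel); congr (mutinf _ * _).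
by apply/funext => u; apply/funext => s; rewrite pU_pS_U.
Qed.

Lemma mutinf_action :
  mutinf (fun (u : U) (y : S * A) => joint pS pUS pAU y.1 u y.2) * ln 2 =
  kl_info pU pSA action_channel.
Proof.
rewrite -(mutinf_channel _ _ _ _ _ pU_dist action_channel_to); congr (mutinf _ * _).
by apply/funext => u; apply/funext => y; rewrite /action_channel mulrA pU_pS_U.
Qed.

Lemma kl_info_null : kl_info pU pSA null_channel = 0.
Proof.
apply: big1 => u _; apply: big1 => y _; rewrite /null_channel.
have [->|nz] := eqVneq (pSA y) 0; first by rewrite mulr0 mul0r.
by rewrite divff // ln1 mulr0.
Qed.

(** Given the state, the action is independent of [u] here, so its factor cancels in the ratio. *)
Lemma kl_info_state : kl_info pU pSA state_channel = kl_info pU pS pS_U.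
Proof.
apply: eq_bigr => u _; rewrite /state_channel /pSA.
rewrite -(pair_bigA _ (fun s a => pU u * (pS_U u s * pAS s a) *
  ln (pS_U u s * pAS s a / (pS s * pAS s a)))) /=.
apply: eq_bigr => s _.
rewrite -[RHS]mulr1 -[X in _ = _ * X](proj2 (pAS_dist s)) mulr_sumr.
apply: eq_bigr => a _.
have [->|nz] := eqVneq (pAS s a) 0; first by rewrite !mulr0 mul0r.
by rewrite -mulf_div divff // mulr1; ring.
Qed.

Lemma pAU_channel s : @channel_to R U A (pUS s) (pAS s) pAU.
Proof. by split. Qed.

(** The action depends on the state only through [U], so given [s] the information is that of [pAU]
    with input law [pUS s]. *)
Lemma cmutinf_channel :
  cmutinf (fun (u : U) (a : A) (s : S) => joint pS pUS pAU s u a) * ln 2 =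
  \sum_s pS s * kl_info (pUS s) (pAS s) pAU.
Proof.
rewrite /cmutinf /kl_info.
under [RHS]eq_bigr do rewrite mulr_sumr.
rewrite [RHS]exchange_big /= mulr_suml; apply: eq_bigr => u _.
under [RHS]eq_bigr do rewrite mulr_sumr.
rewrite [RHS]exchange_big /= mulr_suml; apply: eq_bigr => a _.
rewrite mulr_suml; apply: eq_bigr => s _.
rewrite /log2 -mulrA divfK ?gt_eqF ?ln2_gt0 // /joint !mulrA.
have [z|nz] := eqVneq (pS s * pUS s u * pAU u a) 0; first by rewrite z !mul0r.
congr (_ * ln _).
have := nz; rewrite !mulf_eq0 !negb_or => /andP[/andP[sz uz] az].
have -> : \sum_u' \sum_a' pS s * pUS s u' * pAU u' a' = pS s.
  under eq_bigr => u' _ do rewrite -mulr_sumr (proj2 (hpAU u')) mulr1.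
  by rewrite -mulr_sumr (proj2 (hpUS s)) mulr1.
rewrite -mulr_sumr (proj2 (hpAU u)) mulr1.
have -> : \sum_u' pS s * pUS s u' * pAU u' a = pS s * pAS s a.
  by rewrite /pAS /pA_S mulr_sumr; apply: eq_bigr => u' _; rewrite mulrA.
have [->|asz] := eqVneq (pAS s a) 0; first by rewrite !mulr0 invr0 !mulr0.
by field; rewrite sz uz asz.
Qed.

Lemma cmutinf_ge0 :
  0 <= cmutinf (fun (u : U) (a : A) (s : S) => joint pS pUS pAU s u a).
Proof.
rewrite -(@pmulr_lge0 _ (ln 2)) ?ln2_gt0 // cmutinf_channel.
apply: sumr_ge0 => s _; rewrite mulr_ge0 ?pS_ge0 //.
exact: (kl_info_ge0 (hpUS s) _ (pAU_channel s)).
Qed.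

(** The chain rule [I(U;S,A) = I(U;S) + I(U;A|S)]: on the support, the density ratio is a product of
    the two ratios. *)
Lemma kl_info_action : kl_info pU pSA action_channel = kl_info pU pS pS_U +
  cmutinf (fun (u : U) (a : A) (s : S) => joint pS pUS pAU s u a) * ln 2.
Proof.
rewrite cmutinf_channel /kl_info.
under [X in _ = _ + X]eq_bigr do rewrite mulr_sumr.
rewrite [X in _ = _ + X]exchange_big /= -big_split /=; apply: eq_bigr => u _.
rewrite -(pair_bigA _ (fun s a => pU u * action_channel u (s, a) *
  ln (action_channel u (s, a) / pSA (s, a)))) /= -big_split /=.
apply: eq_bigr => s _.
rewrite -[X in _ = X + _]mulr1 -[X in _ = _ * X + _](proj2 (hpAU u)).
rewrite !mulr_sumr -big_split /=; apply: eq_bigr => a _.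
rewrite /action_channel /pSA /= !mulrA pU_pS_U.
have [z|nz] := eqVneq (pS s * pUS s u * pAU u a) 0.
  by rewrite z !mul0r [X in _ = X + _]mulrAC z mul0r addr0.
rewrite [X in _ = X + _]mulrAC -mulrDr; congr (_ * _).
have := nz; rewrite !mulf_eq0 !negb_or => /andP[/andP[sz uz] az].
have p0 : pU u * pS_U u s != 0 by rewrite pU_pS_U mulf_neq0.
have := p0; rewrite mulf_eq0 negb_or => /andP[_ suz].
have as0 : 0 < pAS s a.
  apply: (channel_output_gt0 (hpUS s) _ u a (pAU_channel s)).
  by rewrite lt0r mulf_neq0 //= mulr_ge0 ?pUS_ge0 ?pAU_ge0.
have s0 : 0 < pS s by rewrite lt0r sz pS_ge0.
have a0 : 0 < pAU u a by rewrite lt0r az pAU_ge0.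
have su0 : 0 < pS_U u s by rewrite lt0r suz (proj1 (pS_U_dist u)).
rewrite -mulf_div.
by rewrite [LHS]lnM ?posrE ?divr_gt0.
Qed.

(** * Achievability from a covering codebook *)

Definition payoff_bound : R := \sum_a \sum_b \sum_s `|Pi a b s|.

Lemma payoff_le_bound a b s : `|Pi a b s| <= payoff_bound.
Proof.
rewrite /payoff_bound (bigD1 a) //= (bigD1 b) //= (bigD1 s) //= -!addrA lerDl.
by rewrite !addr_ge0 //; do ?(apply: sumr_ge0 => ? _).
Qed.

(** The common core of both cases. They differ in the surrogate [Wf] for late rounds and in the
    proof of the three stage conditions; [V u] is a payoff guaranteed when the letter [u] is
    known. *)
Lemma achievable_of_covering (flag : bool) (Wf : U -> S * A -> R) (V : U -> R)
    (theta v1 v2 Rt P : R) :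
  @channel_to R U (S * A)%type pU pSA Wf ->
  v2 <= \sum_u pU u * V u -> 0 <= theta <= 1 ->
  P <= theta * v1 + (1 - theta) * v2 ->
  kl_info pU pS pS_U < Rt * ln 2 ->
  theta * kl_info pU pSA action_channel + (1 - theta) * kl_info pU pSA Wf < Rt * ln 2 ->
  (forall (n k : nat) (sB : 'I_n -> {ffun 'I_n -> S} -> hist S A B n -> B -> R),
     (k <= n)%N -> (0 < #|B|)%N -> (forall i s h, is_dist (sB i s h)) ->
     (~~ flag -> forall i s s' h, sB i s h = sB i s' h) ->
     [/\ (forall (i : 'I_n) (u : 'I_n -> U), (i < k)%N ->
            stage_mean Pi sB i (fun j s a => action_channel (u j) (s, a)) =
            stage_mean Pi sB i (fun j s a =>
              (if (j < k)%N then action_channel else Wf) (u j) (s, a))),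
         (forall i : 'I_n, v1 <= stage_mean Pi sB i (fun _ s a => pSA (s, a))) &
         (forall (i : 'I_n) (u : 'I_n -> U), V (u i) <=
            stage_mean Pi sB i (fun j s a => action_channel (u j) (s, a)))]) ->
  achievable pS Pi flag Rt P.
Proof.
move=> hWf hV hth hP hI0 hI hstage eps eps0.
have M0 : 0 <= payoff_bound by do 3 (apply: sumr_ge0 => ? _).
pose W (b : bool) := if b then action_channel else Wf.
have hW b : @channel_to R U (S * A)%type pU pSA (W b).
  by case: b => //; exact: action_channel_to.
have [N hN] := exists_good_code _ _ _ _ _ _ _ W _ _ _ _ _ _ _ _ pU_dist pS_U_channel
  hW hV hth M0 hP hI0 hI eps0.
exists N => n /hN[n0 [K [k [c [K0 hK kn hL]]]]].
exists K, (likelihood_encoder pS_U c), (code_strategy pAU c); split=> //.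
- by move=> s; apply: likelihood_encoder_dist => // u; exact: pS_U_dist.
- by move=> i m h; exact: hpAU.
move=> sB hsB hinf; apply: (le_trans (ltW hL)).
have B0 := cardB_gt0 _ hpS n0 _ hsB.
have [h1 h2 h3] := hstage n k sB kn B0 hsB hinf.
apply: payoff_ge_covering => //.
- exact: pS_U_dist.
- exact: payoff_le_bound.
Qed.

End Achievability.

(** * Values of the one-round games *)

Section Values.
Context {R : realType}.

(** [inf] is meaningful only with a lower bound, so one is supplied for each of the four values;
    pure strategies then serve as the members [x]. *)
Lemma inf_le_of_bounded (E : set R) (C x : R) :
  (forall y, E y -> `|y| <= C) -> E x -> inf E <= x.
Proof.
move=> hC Ex; apply: ge_inf => //; exists (- C) => y /hC.
by rewrite ler_norml => /andP[].
Qed.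

Lemma norm_weighted_le (p w x : R) : 0 <= w -> w <= 1 -> `|p * w * x| <= `|p * x|.
Proof.
move=> w0 w1; rewrite !normrM (ger0_norm w0) mulrAC.
by rewrite ler_piMr // mulr_ge0.
Qed.

Definition dirac_at {T : finType} (t0 t : T) : R := (t == t0)%:R.

Lemma dirac_at_dist (T : finType) (t0 : T) : is_dist (dirac_at t0).
Proof.
split=> [t|]; first by rewrite ler0n.
rewrite (bigD1 t0) //= /dirac_at eqxx big1 ?addr0 // => t /negbTE.
by rewrite /dirac_at => ->.
Qed.

Lemma sum_dirac (T : finType) (t0 : T) (p : R) (f : T -> R) :
  \sum_t p * dirac_at t0 t * f t = p * f t0.
Proof.
rewrite (bigD1 t0) //= /dirac_at eqxx big1 ?addr0 ?mulr1 // => t /negbTE ->.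
by rewrite mulr0 mul0r.
Qed.

Lemma exchange_sum3 (A B S : finType) (F : A -> B -> S -> R) :
  \sum_a \sum_b \sum_s F a b s = \sum_s \sum_a \sum_b F a b s.
Proof.
under eq_bigr do rewrite exchange_big /=.
by rewrite exchange_big.
Qed.

Lemma exchange_sum4 (A B S U : finType) (F : A -> B -> S -> U -> R) :
  \sum_a \sum_b \sum_s \sum_u F a b s u = \sum_u \sum_s \sum_a \sum_b F a b s u.
Proof.
rewrite exchange_sum3 [RHS]exchange_big /=; apply: eq_bigr => s _.
exact: exchange_sum3.
Qed.

Section Game.
Context {S A B U : finType}.
Variables (pS : S -> R) (Pi : A -> B -> S -> R).
Variables (pUS : S -> U -> R) (pAU : U -> A -> R).

Lemma lowval_le (pAS : S -> A -> R) (b : B) :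
  lowval pS Pi pAS <= \sum_s \sum_a pS s * pAS s a * Pi a b s.
Proof.
apply: (inf_le_of_bounded _ (\sum_a \sum_b \sum_s `|pS s * pAS s a * Pi a b s|)).
  move=> x [pB hB ->].
  do 3 (apply: (le_trans (ler_norm_sum _ _ _)); apply: ler_sum => ? _).
  by apply: norm_weighted_le; [exact: (proj1 hB) | exact: dist_le1].
exists (dirac_at b); first exact: dirac_at_dist.
rewrite exchange_sum3; apply: eq_bigr => s _; apply: eq_bigr => a _.
by rewrite sum_dirac.
Qed.

Lemma lowval_S_le (pAS : S -> A -> R) (b : S -> B) :
  lowval_S pS Pi pAS <= \sum_s pS s * \sum_a pAS s a * Pi a (b s) s.
Proof.
apply: (inf_le_of_bounded _ (\sum_a \sum_b \sum_s `|pS s * pAS s a * Pi a b s|)).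
  move=> x [pB hB ->].
  do 3 (apply: (le_trans (ler_norm_sum _ _ _)); apply: ler_sum => ? _).
  by apply: norm_weighted_le; [exact: (proj1 (hB _)) | exact: dist_le1].
exists (fun s => dirac_at (b s)); first by move=> s; exact: dirac_at_dist.
rewrite exchange_sum3; apply: eq_bigr => s _; rewrite mulr_sumr.
by apply: eq_bigr => a _; rewrite sum_dirac mulrA.
Qed.

Lemma lowval_U_le (b : U -> B) :
  lowval_U pS Pi pUS pAU <=
  \sum_u \sum_s \sum_a pS s * pUS s u * pAU u a * Pi a (b u) s.
Proof.
apply: (inf_le_of_bounded _ (\sum_a \sum_b \sum_s \sum_u
  `|pS s * pUS s u * pAU u a * Pi a b s|)).
  move=> x [pB hB ->].
  do 4 (apply: (le_trans (ler_norm_sum _ _ _)); apply: ler_sum => ? _).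
  by apply: norm_weighted_le; [exact: (proj1 (hB _)) | exact: dist_le1].
exists (fun u => dirac_at (b u)); first by move=> u; exact: dirac_at_dist.
rewrite exchange_sum4; apply: eq_bigr => u _; apply: eq_bigr => s _.
by apply: eq_bigr => a _; rewrite sum_dirac.
Qed.

Lemma lowval_SU_le (b : S -> U -> B) :
  lowval_SU pS Pi pUS pAU <=
  \sum_u \sum_s \sum_a pS s * pUS s u * pAU u a * Pi a (b s u) s.
Proof.
apply: (inf_le_of_bounded _ (\sum_a \sum_b \sum_s \sum_u
  `|pS s * pUS s u * pAU u a * Pi a b s|)).
  move=> x [pB hB ->].
  do 4 (apply: (le_trans (ler_norm_sum _ _ _)); apply: ler_sum => ? _).
  by apply: norm_weighted_le; [exact: (proj1 (hB _ _)) | exact: dist_le1].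
exists (fun s u => dirac_at (b s u)); first by move=> s u; exact: dirac_at_dist.
rewrite exchange_sum4; apply: eq_bigr => u _; apply: eq_bigr => s _.
by apply: eq_bigr => a _; rewrite sum_dirac.
Qed.

End Game.

Lemma exists_minimizer {B : finType} (b0 : B) (g : B -> R) :
  exists b, forall b', g b <= g b'.
Proof.
by case: (@arg_minP _ R B b0 predT g isT) => b _ h; exists b => b'; exact: h.
Qed.

End Values.

(** * Time sharing and the two cases of the theorem *)

Lemma time_sharing (R : realType) (P v1 v2 : R) : v2 < P -> P < v1 ->
  let theta := (P - v2) / (v1 - v2) in
  0 <= theta <= 1 /\ P <= theta * v1 + (1 - theta) * v2.
Proof.
move=> h2 h1 theta; have d0 : 0 < v1 - v2 by lra.
have E : theta * (v1 - v2) = P - v2 by rewrite divfK // gt_eqF.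
split; last by lra.
by rewrite divr_ge0 ?ler_pdivrMr //=; lra.
Qed.

(** Without actions for Player B the values are infima of empty sets. No strategy of Player B exists
    either, so the stage conditions hold vacuously and [v1], [v2] can be set to [P]. *)
Lemma achievable_of_card0 (R : realType) (S A B U : finType) (pS : S -> R)
    (Pi : A -> B -> S -> R) (pUS : S -> U -> R) (pAU : U -> A -> R)
    (flag : bool) (Rt P : R) :
  is_dist pS -> (forall s, is_dist (pUS s)) -> (forall u, is_dist (pAU u)) ->
  #|B| = 0%N -> mutinf (fun u s => pS s * pUS s u) < Rt ->
  achievable pS Pi flag Rt P.
Proof.
move=> hS hUS hAU B0 hI.
have I0 : kl_info (pU pS pUS) pS (pS_U pS pUS) < Rt * ln 2.
  by rewrite -mutinf_state // ltr_pM2r // ln2_gt0.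
have I00 := kl_info_ge0 (pU_dist _ _ hS hUS) _ (pS_U_channel _ _ hS hUS).
apply: (achievable_of_covering _ _ _ _ hS hUS hAU flag
   (null_channel pS pUS pAU) (fun=> P) 0 P P) => //.
- exact: null_channel_to.
- by rewrite -mulr_suml (proj2 (pU_dist _ _ hS hUS)) mul1r.
- by rewrite lexx ler01.
- by rewrite subr0 mul0r add0r mul1r.
- by rewrite mul0r add0r kl_info_null // mulr0 (le_lt_trans I00 I0).
- by move=> n k sB _; rewrite B0.
Qed.

Theorem theorem1 (R : realType) (S A B : finType) (pS : S -> R)
  (Pi : A -> B -> S -> R) (HpS : is_dist pS) :
  (forall Rt P : R,
    (exists (U : finType) (pUS : S -> U -> R) (pAU : U -> A -> R),
      [/\ (forall s, is_dist (pUS s)), (forall u, is_dist (pAU u)),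
          lowval pS Pi (pA_S pUS pAU) > P,
          Rt > mutinf (fun u s => pS s * pUS s u) &
          Rt > mutinf (fun (u : U) (sa : S * A) => joint pS pUS pAU sa.1 u sa.2)
               * ((P - lowval_U pS Pi pUS pAU)
                  / (lowval pS Pi (pA_S pUS pAU) - lowval_U pS Pi pUS pAU))]) ->
    achievable pS Pi false Rt P)
  /\
  (forall Rt P : R,
    (exists (U : finType) (pUS : S -> U -> R) (pAU : U -> A -> R),
      [/\ (forall s, is_dist (pUS s)), (forall u, is_dist (pAU u)),
          lowval_S pS Pi (pA_S pUS pAU) > P &
          Rt > mutinf (fun u s => pS s * pUS s u)
               + cmutinf (fun (u : U) (a : A) (s : S) => joint pS pUS pAU s u a)
                 * Num.max ((P - lowval_SU pS Pi pUS pAU)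
                      / (lowval_S pS Pi (pA_S pUS pAU) - lowval_SU pS Pi pUS pAU)) 0]) ->
    achievable pS Pi true Rt P).
Proof.
have ln20 := @ln2_gt0 R.
split=> Rt P [U [pUS [pAU [hUS hAU hP]]]].
  move=> hI0 hI1.
  have I0 : kl_info (pU pS pUS) pS (pS_U pS pUS) < Rt * ln 2.
    by rewrite -mutinf_state // ltr_pM2r.
  have I00 := kl_info_ge0 (pU_dist _ _ HpS hUS) _ (pS_U_channel _ _ HpS hUS).
  have [b0 _|noB] := pickP (@predT B); last first.
    exact: (achievable_of_card0 _ _ _ _ _ _ _ _ _ _ _ _ HpS hUS hAU (eq_card0 noB)).
  (* The best reply [bm u] to a known letter defines [V u]: no reply does better against [u], and
     since [bm] competes in [lowval_U], the mean of [V] is at least [v2]. *)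
  pose g u b := \sum_s \sum_a pS_U pS pUS u s * pAU u a * Pi a b s.
  have /choice[bm hbm] u := exists_minimizer b0 (g u).
  set v1 := lowval _ _ _ in hP hI1 *; set v2 := lowval_U _ _ _ _ in hI1 *.
  have achieve theta : 0 <= theta <= 1 -> P <= theta * v1 + (1 - theta) * v2 ->
      theta * (mutinf (fun (u : U) (sa : S * A) => joint pS pUS pAU sa.1 u sa.2) * ln 2)
        < Rt * ln 2 -> achievable pS Pi false Rt P.
    move=> hth hPth hIth.
    apply: (achievable_of_covering _ _ _ _ HpS hUS hAU false
       (null_channel pS pUS pAU) (fun u => g u (bm u)) theta v1 v2) => //.
    - exact: null_channel_to.
    - apply: (le_trans (lowval_U_le _ _ _ _ bm)); rewrite le_eqVlt; apply/orP; left.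
      apply/eqP; apply: eq_bigr => u _; rewrite mulr_sumr; apply: eq_bigr => s _.
      rewrite mulr_sumr; apply: eq_bigr => a _.
      by rewrite -(pU_pS_U _ _ HpS hUS) !mulrA.
    - by rewrite -mutinf_action // kl_info_null // mulr0 addr0.
    move=> n k sB kn B0 hsB /(_ isT) hunif.
    have dA u : is_dist (fun y : S * A => action_channel pS pUS pAU u (y.1, y.2)).
      exact: (proj1 (action_channel_to _ _ _ HpS hUS hAU) u).
    have dN u : is_dist (fun y : S * A => null_channel pS pUS pAU u (y.1, y.2)).
      exact: (proj1 (null_channel_to _ _ _ HpS hUS hAU) u).
    split=> [i u ik|i|i u].
    - apply: (stage_mean_prefix_uninformed _ _ hsB hunif i k) => // [j|j jk].
        by case: ifP => _; [exact: dA | exact: dN].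
      by rewrite jk.
    - apply: stage_mean_ge_uninformed => // [j|b].
        exact: (prod_dist2 _ _ _ pS (pA_S pUS pAU) HpS (pAS_dist _ _ hUS hAU)).
      exact: lowval_le.
    - apply: stage_mean_ge_uninformed => // [b]; exact: hbm.
  (* If the payoff is reached even with the message known, no round needs hiding and [theta = 0]. *)
  have [hPv2|hv2P] := leP P v2.
    apply: (achieve 0); first by rewrite lexx ler01.
      by rewrite subr0 mul0r add0r mul1r.
    by rewrite mul0r (le_lt_trans I00 I0).
  have [th01 hPth] := time_sharing _ _ _ _ hv2P hP.
  apply: (achieve _ th01 hPth).
  by rewrite mulrA ltr_pM2r // mulrC.
move=> hI.
set v1 := lowval_S _ _ _ in hP hI *; set v2 := lowval_SU _ _ _ _ in hI *.
set IS := mutinf _ in hI; set IA := cmutinf _ in hI; set mx := Num.max _ _ in hI.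
have KS : kl_info (pU pS pUS) pS (pS_U pS pUS) = IS * ln 2 by rewrite mutinf_state.
have KA : kl_info (pU pS pUS) (pSA pS pUS pAU) (action_channel pS pUS pAU) =
    (IS + IA) * ln 2.
  by rewrite kl_info_action // KS mulrDl.
have IA0 : 0 <= IA := cmutinf_ge0 _ _ _ HpS hUS hAU.
have mx0 : 0 <= mx by rewrite le_max lexx orbT.
(* The positive part secures [R > I(U;S)], which the encoder needs in all cases. *)
have hIS : IS < Rt by apply: le_lt_trans hI; rewrite lerDl mulr_ge0.
have I0 : kl_info (pU pS pUS) pS (pS_U pS pUS) < Rt * ln 2 by rewrite KS ltr_pM2r.
have [b0 _|noB] := pickP (@predT B); last first.
  exact: (achievable_of_card0 _ _ _ _ _ _ _ _ _ _ _ _ HpS hUS hAU (eq_card0 noB)).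
have /choice[b1 hb1] s :=
  exists_minimizer b0 (fun b => \sum_a pA_S pUS pAU s a * Pi a b s).
have /choice[b2 hb2] (su : S * U) :=
  exists_minimizer b0 (fun b => \sum_a pAU su.2 a * Pi a b su.1).
have achieve theta : 0 <= theta <= 1 -> P <= theta * v1 + (1 - theta) * v2 ->
    IS + theta * IA < Rt -> achievable pS Pi true Rt P.
  move=> hth hPth hIth.
  apply: (achievable_of_covering _ _ _ _ HpS hUS hAU true (state_channel pS pUS pAU)
    (fun u => \sum_s pS_U pS pUS u s * \sum_a pAU u a * Pi a (b2 (s, u)) s)
    theta v1 v2) => //.
  - exact: state_channel_to.
  - apply: (le_trans (lowval_SU_le _ _ _ _ (fun s u => b2 (s, u)))).
    rewrite le_eqVlt; apply/orP; left; apply/eqP; apply: eq_bigr => u _.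
    rewrite mulr_sumr; apply: eq_bigr => s _.
    rewrite mulrA (pU_pS_U _ _ HpS hUS) mulr_sumr; apply: eq_bigr => a _.
    by rewrite mulrA.
  (* [theta * (IS + IA) + (1 - theta) * IS = IS + theta * IA]. *)
  - by rewrite KA kl_info_state // KS; nra.
  move=> n k sB kn B0 hsB _.
  have dA := pAS_dist _ _ hUS hAU.
  split=> [i u ik|i|i u].
  (* From round [k] on, the action law given the codeword is replaced by that given the state, as in
     [state_channel]; the states still follow the codeword. *)
  - rewrite (stage_mean_prefix_informed Pi sB hsB i k (fun j => pS_U pS pUS (u j))
      (fun j _ => pAU (u j))
      (fun j s => if (j < k)%N then pAU (u j) else pA_S pUS pAU s)) //.
    + congr (stage_mean Pi sB i _).
      apply/funext => j; apply/funext => s; apply/funext => a.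
      by case: ltnP.
    + by move=> j s; case: ifP.
    + by move=> j jk; apply/funext => s; rewrite jk.
  - apply: (le_trans (lowval_S_le _ _ _ b1)).
    by apply: (stage_mean_ge_informed Pi sB hsB B0 i (fun=> pS) (fun=> pA_S pUS pAU)).
  - apply: (stage_mean_ge_informed Pi sB hsB B0 i (fun j => pS_U pS pUS (u j))
      (fun j _ => pAU (u j))) => // [j|s b].
      exact: pS_U_dist.
    exact: (hb2 (s, u i)).
have [hPv2|hv2P] := leP P v2.
  apply: (achieve 0); first by rewrite lexx ler01.
    by rewrite subr0 mul0r add0r mul1r.
  by rewrite mul0r addr0.
have [th01 hPth] := time_sharing _ _ _ _ hv2P hP.
apply: (achieve _ th01 hPth).
by apply: le_lt_trans hI; rewrite lerD2l mulrC ler_wpM2l // le_max lexx.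
Qed.
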